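(* Let $u_0\in H^1(\mathcal O)$. Then for every $p\ge2$, $$\sup_{\tau\in(0,1),\,N\ge2}\ \sup_{m\ge0}\mathbb E\big[\|u^{\tau,N}(t_m,\cdot)\|^p_{L^\infty}\big]<\infty\quad\text{and}\quad\sup_{\tau\in(0,1),\,N\ge2}\ \sup_{m\ge0}\mathbb E\big[\|U^{\tau,N}_{t_m}\|^p_{w^{1,2}_N}\big]<\infty.$$
   Context: Let $\mathcal O=(0,\pi)$, $\phi_0\equiv\pi^{-1/2}$, $\phi_j(x)=\sqrt{2/\pi}\cos(jx)$ ($j\ge1$). Assume $f(x)=a_0x^3+a_1x^2+a_2x+a_3$ with $a_0>0$, $a_i\in\mathbb R$, and $\sup_{x\in\mathbb R}(-f'(x))<1$. Let $\{\beta_j\}_{j\ge1}$ be independent standard Brownian motions, $\sigma\in\mathbb R$. Numerical scheme: for $N\ge2$, $h=\pi/N$, $x_i=(i-\frac12)h$. On $\mathbb R^N$ use $\langle\vec u,\vec v\rangle_{l^2_N}=h\sum_iu_iv_i$, $\|\vec u\|_{l^p_N}=(h\sum_i|u_i|^p)^{1/p}$, $\|\vec u\|_{l^\infty_N}=\max_i|u_i|$. $A_N=\frac{N^2}{\pi^2}M$ where $M$ is the $N\times N$ tridiagonal matrix with diagonal $(-1,-2,\dots,-2,-1)$ and off-diagonal entries $1$. $\phi_{N,j}=(\phi_j(x_1),\dots,\phi_j(x_N))^\top$, $j=0,\dots,N-1$, is an $l^2_N$-orthonormal eigenbasis with $-A_N\phi_{N,j}=\lambda_{N,j}\phi_{N,j}$,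 $\lambda_{N,j}=\frac{4N^2}{\pi^2}\sin^2(\frac{j\pi}{2N})$. $(-A_N)^{1/2}\vec v=\sum_j\lambda_{N,j}^{1/2}\langle\vec v,\phi_{N,j}\rangle_{l^2_N}\phi_{N,j}$ and $\|\vec v\|_{w^{1,2}_N}=(\|\vec v\|^2_{l^2_N}+\|(-A_N)^{1/2}\vec v\|^2_{l^2_N})^{1/2}$. $F_N(\vec v)=(f(v_1),\dots,f(v_N))^\top$, and for a time step $\tau\in(0,1)$, $\tilde F_N(\vec v)=F_N(\vec v)/(1+\tau\|\vec v\|^{12}_{w^{1,2}_N})$. Let $t_m=m\tau$ and $\lfloor t\rfloor=t_m$ for $t\in[t_m,t_{m+1})$, $u_0^N=(u_0(x_1),\dots,u_0(x_N))^\top$. The fully discrete (strongly tamed exponential Euler / finite difference) approximation is $$U^{\tau,N}_t=e^{-A_N^2t}u_0^N+\int_0^tA_Ne^{-A_N^2(t-\lfloor s\rfloor)}\tilde F_N(U^{\tau,N}_{\lfloor s\rfloor})ds+\sigma\sum_{j=1}^{N-1}\int_0^te^{-A_N^2(t-\lfloor s\rfloor)}\phi_{N,j}\,d\beta_j(s),$$ equivalently $U^{\tau,N}_{t_{m+1}}=e^{-A_N^2\tau}U^{\tau,N}_{t_m}+\tau A_Ne^{-A_N^2\tau}\tilde F_N(U^{\tau,N}_{t_m})+\sigma e^{-A_N^2\tau}\sum_{j=1}^{N-1}(\beta_j(t_{m+1})-\beta_j(t_m))\phi_{N,j}$. $P_N$ is piecewise linear interpolation ($P_N\vec v=v_1$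 on $[0,x_1]$, linear between $x_i,x_{i+1}$, $=v_N$ on $[x_N,\pi]$), and $u^{\tau,N}(t,\cdot)=P_NU^{\tau,N}_t$. *)

(* Defs.v *)
From HB Require Import structures.
From mathcomp Require Import all_boot all_order all_algebra.
From mathcomp Require Import all_classical all_reals all_analysis.
Set Implicit Arguments. Unset Strict Implicit. Unset Printing Implicit Defensive.
Import Order.TTheory GRing.Theory Num.Theory.
Import numFieldNormedType.Exports.
Local Open Scope classical_set_scope.
Local Open Scope ring_scope.

Section Defs.
Variable R : realType.

(** [beta j t w] : a family {beta_j}_{j>=1} of independent standard
    (real) Brownian motions on the probability space (T, P).
    Independence of the family (across j and across non-overlapping time
    intervals) is stated as the product rule for every finite family of
    increments over pairwise non-overlapping intervals (for equal j). *)
Definition indep_std_BMs {d : measure_display} {T : measurableType d}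
  (P : probability T R) (beta : nat -> R -> T -> R) : Prop :=
  [/\ (forall j t, (0 < j)%N -> 0 <= t -> measurable_fun setT (beta j t)),
      (forall j w, (0 < j)%N -> beta j 0 w = 0),
      (forall j w, (0 < j)%N ->
          {within `[0, +oo[%classic, continuous (fun t => beta j t w)}),
      (forall j s t, (0 < j)%N -> 0 <= s -> s < t ->
         forall B : set R, measurable B ->
         P [set w | beta j t w - beta j s w \in B] =
         normal_prob 0 (Num.sqrt (t - s)) B) &
      (forall (k : nat) (js : 'I_k -> nat) (s t : 'I_k -> R) (B : 'I_k -> set R),
         (forall i, [/\ (0 < js i)%N, 0 <= s i, s i < t i & measurable (B i)]) ->
         (forall i i', i != i' -> js i = js i' -> t i <= s i' \/ t i' <= s i) ->
         P (\bigcap_(i in [set: 'I_k])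
              [set w | beta (js i) (t i) w - beta (js i) (s i) w \in B i]) =
         (\prod_(i < k)
              P [set w | (beta (js i) (t i) w - beta (js i) (s i) w)%R \in B i])%E)].

Definition itv0 (x : R) : set R := `[0, x].

(** u0 (a pointwise-defined representative) belongs to H^1(0,pi):
    it is absolutely continuous on [0,pi] with a derivative in L^2(0,pi). *)
Definition in_H1 (u0 : R -> R) : Prop :=
  exists g : R -> R,
    [/\ measurable_fun (itv0 pi) g,
        (\int[lebesgue_measure]_(y in itv0 pi) ((g y) ^+ 2)%:E < +oo)%E &
        forall x, 0 <= x <= pi ->
          lebesgue_measure.-integrable (itv0 x) (fun y => (g y)%:E) /\
          (\int[lebesgue_measure]_(y in itv0 x) (g y)%:E)%E = (u0 x - u0 0)%:E].

(** Vectors of R^N are represented as [nat -> R]; only the entries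
    0, ..., N-1 are relevant (entry i is the paper's entry i+1). *)
Definition vec := nat -> R.

Definition hN (N : nat) : R := pi / N%:R.
(** grid point x_{i+1} = (i + 1/2) h (0-based index i) *)
Definition xN (N i : nat) : R := (i%:R + 2^-1) * hN N.

Definition phi (j : nat) (x : R) : R :=
  if j == 0%N then (Num.sqrt pi)^-1 else Num.sqrt (2 / pi) * cos (j%:R * x).
Definition phiN (N j : nat) : vec := fun i => phi j (xN N i).

Definition l2ip (N : nat) (u v : vec) : R := hN N * \sum_(i < N) u i * v i.
Definition l2norm (N : nat) (v : vec) : R := Num.sqrt (l2ip N v v).

Definition lamN (N j : nat) : R :=
  4 * N%:R ^+ 2 / pi ^+ 2 * (sin (j%:R * pi / (2 * N%:R))) ^+ 2.

Definition sqrtmA (N : nat) (v : vec) : vec :=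
  fun i => \sum_(j < N) Num.sqrt (lamN N j) * l2ip N v (phiN N j) * phiN N j i.

Definition w12norm (N : nat) (v : vec) : R :=
  Num.sqrt (l2norm N v ^+ 2 + l2norm N (sqrtmA N v) ^+ 2).

(** A_N = N^2/pi^2 M, M tridiagonal with diagonal (-1,-2,...,-2,-1)
    and off-diagonal entries 1 *)
Definition AN (N : nat) (v : vec) : vec :=
  fun i => N%:R ^+ 2 / pi ^+ 2 *
    ((if i == 0%N then 0 else v i.-1)
     - (if (i == 0%N) || (i == N.-1) then 1 else 2) * v i
     + (if i == N.-1 then 0 else v i.+1)).

(** e^{-A_N^2 t} v, through the l^2_N-orthonormal eigenbasis of A_N
    (-A_N phi_{N,j} = lambda_{N,j} phi_{N,j}, hence
     e^{-A_N^2 t} phi_{N,j} = e^{-lambda_{N,j}^2 t} phi_{N,j}). *)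
Definition semigN (N : nat) (t : R) (v : vec) : vec :=
  fun i => \sum_(j < N) expR (- (lamN N j ^+ 2) * t) * l2ip N v (phiN N j) * phiN N j i.

Definition fcub (a0 a1 a2 a3 : R) (x : R) : R :=
  a0 * x ^+ 3 + a1 * x ^+ 2 + a2 * x + a3.

Definition FtN (a0 a1 a2 a3 : R) (N : nat) (tau : R) (v : vec) : vec :=
  fun i => fcub a0 a1 a2 a3 (v i) / (1 + tau * w12norm N v ^+ 12).

Fixpoint Uscheme {T : Type} (a0 a1 a2 a3 sigma : R) (beta : nat -> R -> T -> R)
  (u0 : R -> R) (N : nat) (tau : R) (w : T) (m : nat) : vec :=
  match m with
  | 0%N => fun i => u0 (xN N i)
  | m'.+1 =>
      let Um := Uscheme a0 a1 a2 a3 sigma beta u0 N tau w m' in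
      fun i =>
        semigN N tau Um i
        + tau * AN N (semigN N tau (FtN a0 a1 a2 a3 N tau Um)) i
        + sigma * semigN N tau
            (fun k => \sum_(1 <= j < N)
                (beta j (m'.+1%:R * tau) w - beta j (m'%:R * tau) w) * phiN N j k) i
  end.

Definition PN (N : nat) (v : vec) (x : R) : R :=
  if x <= xN N 0 then v 0%N
  else if xN N N.-1 <= x then v N.-1
  else \sum_(k < N.-1)
         (if (xN N k <= x) && (x < xN N k.+1)
          then v k + (v k.+1 - v k) * (x - xN N k) / hN N else 0).

Definition Linf_norm (g : R -> R) : R :=
  sup [set y | exists2 x, 0 < x < pi & y = `|g x|].

End Defs.

(* Main.v *)
(** Split the scheme into cosine modes as [U = Y + O], where [O] is the linear part (decayed
    initial datum plus discrete stochastic convolution) and [Y] starts at [0] and keeps mean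
    zero.  Each mode of the stochastic part of [O] is a sum of independent Gaussians of total
    variance at most [sigma^2 / (2 lam_j^2)], so its exponential moments bound every moment of
    the [w12] norm of [O] uniformly.

    Pathwise, [|Y'|^2 <= (1 - tau / 18) |Y|^2 + C tau (1 + |O|_w12^2)^4] in one step.  The
    nonlinearity is tested not against [Y] but against [Yt = exp(-2 A^2 tau) Y]: then
    [tau |A Yt|^2] is controlled by the dissipation, the coercivity of the cubic produces
    [- |Yt|_oo^4], which absorbs all mixed terms in [Y] and [O], and exchanging [Y] for [Yt]
    costs [sqrt tau * E^6] with [E = |U|_w12], exactly what the taming factor
    [1 / (1 + tau E^12)] compensates.

    Finally the mode [j] of [Y] contracts towards [1 / lam_j] times the [L^1] norm of the flux,
    whose square is at most [eps |grad Y|^2 + C (1 + |Y|^2 + |O|_w12^2)^5].  As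
    [sum_j 1 / lam_j <= 8], the moments of [|grad Y|] close by strong induction on the time
    step, and the discrete Sobolev inequality gives the [L^oo] bound. *)
Require Import Defs.
From HB Require Import structures.
From mathcomp Require Import all_boot all_order all_algebra.
From mathcomp Require Import all_classical all_reals all_analysis.
From mathcomp Require Import measurable_realfun.
From mathcomp Require Import ring lra zify.
Import Order.TTheory GRing.Theory Num.Theory.
Import numFieldNormedType.Exports.
Local Open Scope classical_set_scope.
Local Open Scope ring_scope.
Set Implicit Arguments. Unset Strict Implicit. Unset Printing Implicit Defensive.

(** The test vector [Yt] is forced by the scheme: squaring a step [exp(-A^2 tau) (Y + tau A F)] puts
    the factor [exp(-2 A^2 tau)] on the cross term. The dissipation of one step,
    [<(1 - exp(-2 A^2 tau)) Y, Y>], dominates [tau |A Yt|^2] but not [tau |A Y|^2], because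
    [tau lam_j^2] is unbounded when [tau] and [N] are unrelated. The power of the taming factor
    arises as follows. The square of [F(U) - F(Yt + O)] brings a squared Lipschitz constant of order
    [|U|^4] times [|Y - Yt|^2], and [(1 - exp(-2 lam^2 tau))^2 <= 2 lam sqrt tau] bounds the latter
    by [sqrt tau] times a squared [w12] norm. The gradient is treated mode by mode because a flux
    bound uniform in [j] acquires the weight [lam_j * lam_j^-2], which is summable in dimension one.
    That bound still contains the gradient, so [eps] must beat the total weight [8]. Uniformity in
    time comes from one mechanism: every recursion is dominated by a convex combination of the old
    value and a forcing with bounded moments. *)

(** * Elementary bounds for the sine *)

Section Trig.
Variable R : realType.
Implicit Types x : R.

Lemma mul_cos_le_sin x : 0 <= x <= pi / 2 -> x * cos x <= sin x.
Proof.
move=> /andP[x0 x1].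
have [|c] := @MVT_segment R (@sin R) (@cos R) 0 x x0 (fun y _ => is_derive_sin y).
  by apply: continuous_subspaceT => y; exact: continuous_sin.
rewrite in_itv /= sin0 !subr0 => /andP[c0 cx] ->.
rewrite mulrC ler_wpM2r//.
have ppi := pi_gt0 R; have pn0 : (pi : R) != 0 by rewrite gt_eqF.
have [->//|ne] := eqVneq c x.
apply/ltW; rewrite ltr_cos ?in_itv /=; first by rewrite lt_neqAle ne cx.
all: apply/andP; split; lra.
Qed.

(** Half-angle formulas: [sin x = 2 cos(x/2) sin(x/2) >= x cos(x/2)^2 = x (1 + cos x) / 2], and
    [cos x >= 0] on this range. This is what makes the discrete eigenvalues grow like [j^2]. *)
Lemma half_le_sin x : 0 <= x <= pi / 2 -> x / 2 <= sin x.
Proof.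
move=> /andP[x0 x1].
have ppi := pi_gt0 R; have pn0 : (pi : R) != 0 by rewrite gt_eqF.
have h1 : x / 2 * cos (x / 2) <= sin (x / 2) by apply: mul_cos_le_sin; lra.
have c0 : 0 <= cos (x / 2) by apply: cos_ge0_pihalf; lra.
have cx0 : 0 <= cos x by apply: cos_ge0_pihalf; lra.
have e1 : sin x = 2 * (cos (x / 2) * sin (x / 2)).
  have {1}-> : x = (x / 2) *+ 2 by rewrite mulr2n; lra.
  by rewrite sin_mulr2n [LHS]mulr2n; ring.
have e2 : cos x = 2 * (cos (x / 2)) ^+ 2 - 1.
  have {1}-> : x = (x / 2) *+ 2 by rewrite mulr2n; lra.
  by rewrite cos_mulr2n mulr2n; ring.
have h2 := ler_wpM2l c0 h1.
rewrite e1; rewrite e2 in cx0; nra.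
Qed.

Lemma sin_natpi (l : nat) : sin (l%:R * pi) = 0 :> R.
Proof.
elim: l => [|l IH]; first by rewrite mul0r sin0.
by rewrite -natr1 mulrDl mul1r sinDpi IH oppr0.
Qed.

End Trig.

(** * The discrete cosine transform and the spectrum of the discrete Neumann Laplacian *)

Section CosineBasis.
Variables (R : realType) (N : nat).
Hypothesis N2 : (2 <= N)%N.

Let N0 : (0 : R) < N%:R.
Proof. by rewrite ltr0n; case: N N2. Qed.

Let Nn0 : (N%:R : R) != 0. Proof. by rewrite gt_eqF. Qed.

Lemma hN_gt0 : 0 < hN R N.
Proof. by rewrite divr_gt0 // pi_gt0. Qed.

Lemma hNN : N%:R * hN R N = pi.
Proof. by rewrite /hN mulrCA divff ?mulr1. Qed.

(** After multiplication by [sin(l h / 2)] the sum telescopes to [sin(l pi) / 2 = 0]. The bound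
    [l < 2 N] keeps [l h / 2] strictly below [pi], so the multiplier does not vanish. *)
Lemma sum_cos_grid (l : nat) :
  (l < N.*2)%N -> \sum_(i < N) cos (l%:R * xN R N i) = if l == 0%N then N%:R else 0.
Proof.
move=> lN; case: eqP => [->|/eqP l0].
  under eq_bigr do rewrite mul0r cos0.
  by rewrite sumr_const card_ord.
have ppi := pi_gt0 R; have pn0 : (pi : R) != 0 by rewrite gt_eqF.
have l0' : (0 : R) < l%:R by rewrite ltr0n lt0n.
have s0 : sin (l%:R * hN R N / 2) != 0.
  rewrite gt_eqF// sin_gt0_pi//; apply/andP; split.
    by rewrite divr_gt0// mulr_gt0// hN_gt0.
  rewrite -hNN mulrAC ltr_pM2r ?hN_gt0// ltr_pdivrMr// -natrM ltr_nat; lia.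
apply: (mulfI s0); rewrite mulr0 mulr_sumr.
suff -> : \sum_(i < N) sin (l%:R * hN R N / 2) * cos (l%:R * xN R N i) =
          \sum_(0 <= i < N) 2^-1 * (sin (l%:R * (i.+1%:R * hN R N)) - sin (l%:R * (i%:R * hN R N))).
  rewrite -mulr_sumr telescope_sumr// mul0r mulr0 sin0 subr0 hNN sin_natpi mulr0 //.
rewrite big_mkord; apply: eq_bigr => i _.
rewrite -[i.+1%:R]natr1.
rewrite (_ : l%:R * ((i%:R + 1) * hN R N) = l%:R * xN R N i + l%:R * hN R N / 2); last by rewrite /xN; field.
rewrite (_ : l%:R * (i%:R * hN R N) = l%:R * xN R N i - l%:R * hN R N / 2); last by rewrite /xN; field.
by rewrite sinD sinB; field.
Qed.

Definition phi_scale (j : nat) : R := if j == 0%N then (Num.sqrt pi)^-1 else Num.sqrt (2 / pi).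

Lemma phiE j (x : R) : phi j x = phi_scale j * cos (j%:R * x).
Proof. by rewrite /phi /phi_scale; case: eqP => [->|//]; rewrite mul0r cos0 mulr1. Qed.

Lemma norm_phi_le1 j (x : R) : `|phi j x| <= 1.
Proof.
have p2 := pi_ge2 R.
have p0 := pi_gt0 R.
have n1 : 0 <= phi_scale j <= 1.
  rewrite /phi_scale; case: eqP => _.
    rewrite invr_ge0 sqrtr_ge0 /= invf_le1 ?sqrtr_gt0 //.
    by rewrite -[X in X <= _]sqrtr1 ler_sqrt //; lra.
  rewrite sqrtr_ge0 /= -[X in _ <= X]sqrtr1 ler_sqrt // ler_pdivrMr //; lra.
move/andP: n1 => [n0 n1].
rewrite phiE normrM ger0_norm //.
have := cos_max (j%:R * x); have := normr_ge0 (cos (j%:R * x)); nra.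
Qed.

Lemma phiN_orthonormal j k : (j < N)%N -> (k < N)%N ->
  l2ip N (phiN R N j) (phiN R N k) = (j == k)%:R.
Proof.
wlog kj : j k / (k <= j)%N.
  move=> H jN kN; have [kj|/ltnW jk] := leqP k j; first exact: H.
  rewrite eq_sym -H // /l2ip; congr (_ * _); apply: eq_bigr => i _; exact: mulrC.
move=> jN kN.
have -> : l2ip N (phiN R N j) (phiN R N k) = phi_scale j * phi_scale k * hN R N / 2 *
    (\sum_(i < N) cos ((j + k)%:R * xN R N i) + \sum_(i < N) cos ((j - k)%:R * xN R N i)).
  rewrite /l2ip -big_split /= !mulr_sumr; apply: eq_bigr => i _.
  rewrite /phiN !phiE natrD natrB // mulrDl mulrBl cosD cosB; by field.
rewrite !sum_cos_grid; [|lia|lia].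
have ppi := pi_gt0 R; have pn0 : (pi : R) != 0 by rewrite gt_eqF.
have [jk|jk] := eqVneq j k.
  subst k; rewrite subnn eqxx addnn double_eq0 /phi_scale.
  have [_|_] := eqVneq j 0%N.
    have -> : (Num.sqrt pi)^-1 / Num.sqrt pi = (pi : R)^-1.
      by rewrite -invfM -expr2 sqr_sqrtr // ltW.
    by rewrite /hN -[true%:R]/1; move: (pi : R) pn0 => q pn0; field; rewrite pn0 Nn0.
  rewrite -expr2 sqr_sqrtr ?divr_ge0 ?ltW //.
  by rewrite /hN add0r -[true%:R]/1; move: (pi : R) pn0 => q pn0; field; rewrite pn0 Nn0.
have -> : (j + k == 0)%N = false by lia.
have -> : (j - k == 0)%N = false by lia.
by rewrite addr0 mulr0.
Qed.

(** Orthonormality is a one-sided inverse relation between square matrices, hence a two-sided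
    one. *)
Lemma phiN_complete i k : (i < N)%N -> (k < N)%N ->
  \sum_(j < N) hN R N * phiN R N j i * phiN R N j k = (i == k)%:R.
Proof.
move=> iN kN.
pose A := \matrix_(j < N, i < N) phiN R N j i.
pose B := \matrix_(i < N, j < N) (hN R N * phiN R N j i).
have AB : A *m B = 1%:M.
  apply/matrixP => j l; rewrite !mxE -[RHS]/((j == l)%:R) -[j == l]/(j == l :> nat).
  rewrite -phiN_orthonormal // /l2ip mulr_sumr; apply: eq_bigr => m _.
  by rewrite !mxE mulrCA.
have := mulmx1C AB => /matrixP /(_ (Ordinal iN) (Ordinal kN)).
rewrite !mxE -[Ordinal iN == _]/(i == k) => <-.
by apply: eq_bigr => m _; rewrite !mxE.
Qed.

(** [coef] is the discrete cosine transform and [syn] its inverse. From here on most estimates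
    concern coefficient sequences, of which only the indices below [N] matter. *)
Definition coef (v : vec R) (j : nat) : R := l2ip N v (phiN R N j).
Definition syn (a : nat -> R) : vec R := fun i => \sum_(j < N) a j * phiN R N j i.

Lemma eq_l2ip (u u' v v' : vec R) : (forall i, (i < N)%N -> u i = u' i) ->
  (forall i, (i < N)%N -> v i = v' i) -> l2ip N u v = l2ip N u' v'.
Proof.
by move=> uu vv; congr (_ * _); apply: eq_bigr => i _; rewrite uu ?vv.
Qed.

Lemma l2ipC (u v : vec R) : l2ip N u v = l2ip N v u.
Proof. by congr (_ * _); apply: eq_bigr => i _; rewrite mulrC. Qed.

Lemma l2ip_syn (v : vec R) a : l2ip N v (syn a) = \sum_(j < N) a j * coef v j.
Proof.
rewrite /l2ip /syn.
under eq_bigr do rewrite mulr_sumr.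
rewrite exchange_big mulr_sumr; apply: eq_bigr => j _.
rewrite /coef /l2ip !mulr_sumr; apply: eq_bigr => i _; ring.
Qed.

Lemma coef_syn a j : (j < N)%N -> coef (syn a) j = a j.
Proof.
move=> jN; rewrite /coef l2ipC l2ip_syn (bigD1 (Ordinal jN)) //= /coef.
rewrite phiN_orthonormal // eqxx mulr1 big1 ?addr0 // => i ij.
rewrite phiN_orthonormal // (_ : _ == _ = false) ?mulr0 //.
by apply: contraNF ij => /eqP ji; apply/eqP/val_inj.
Qed.

Lemma syn_coef (v : vec R) i : (i < N)%N -> syn (coef v) i = v i.
Proof.
move=> iN; rewrite /syn /coef /l2ip.
under eq_bigr do rewrite mulr_sumr mulr_suml.
rewrite exchange_big /= (bigD1 (Ordinal iN)) //=.
have E (k : 'I_N) : \sum_(j < N) hN R N * (v k * phiN R N j k) * phiN R N j i = v k * (k == i :> nat)%:R.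
  rewrite -phiN_complete // mulr_sumr; apply: eq_bigr => j _; ring.
rewrite (E (Ordinal iN)) /= eqxx mulr1 big1 ?addr0 // => k ki; rewrite E (_ : _ == _ = false) ?mulr0 //.
by apply: contraNF ki => /eqP ji; apply/eqP/val_inj.
Qed.

Lemma parseval (u v : vec R) : l2ip N u v = \sum_(j < N) coef u j * coef v j.
Proof.
rewrite (@eq_l2ip u u v (syn (coef v))) // ?l2ip_syn; last by move=> i iN; rewrite syn_coef.
by apply: eq_bigr => j _; rewrite mulrC.
Qed.

(** The discrete Dirichlet form: [h] times the sum of products of difference quotients. *)
Definition dform (u v : vec R) : R :=
  (hN R N)^-1 * \sum_(l < N.-1) (u l.+1 - u l) * (v l.+1 - v l).

Lemma dformC (u v : vec R) : dform u v = dform v u.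
Proof. by congr (_ * _); apply: eq_bigr => i _; rewrite mulrC. Qed.

(** Summation by parts. The corner entries [-1] of the matrix encode the Neumann condition, so no
    boundary terms remain. *)
Lemma l2ip_AN (u v : vec R) : l2ip N (AN N u) v = - dform u v.
Proof.
have hh : N%:R ^+ 2 / pi ^+ 2 = (hN R N)^-2.
  by rewrite /hN expr_div_n invf_div.
rewrite /l2ip /dform /AN; under eq_bigr do rewrite hh -mulrA.
rewrite -mulr_sumr mulrA (_ : hN R N * hN R N ^- 2 = (hN R N)^-1); last first.
  by field; rewrite gt_eqF ?hN_gt0.
rewrite -mulrN; congr (_ * _).
case: N N2 => [|[|n]] // _; rewrite /=.
(* Forward and backward differences, set to zero where they would leave the grid. *)
pose up i := if i == n.+1 then 0 else u i.+1 - u i.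
pose dn i := if i == 0%N then 0 else u i - u i.-1.
transitivity (\sum_(i < n.+2) up i * v i - \sum_(i < n.+2) dn i * v i).
  rewrite -sumrB; apply: eq_bigr => -[i /= _] _; rewrite /up /dn.
  case: i => [|i] /=; first by rewrite mul1r; ring.
  by case: eqP => _; ring.
rewrite big_ord_recr /= {2}/up eqxx mul0r addr0.
rewrite [X in _ - X]big_ord_recl /= {1}/dn mul0r add0r -sumrB -sumrN.
apply: eq_bigr => -[i /= il] _; rewrite /up /dn /=.
have -> : (i == n.+1) = false by lia.
rewrite /bump /=; ring.
Qed.

(** The cosine is even about [0] and about [pi], and the grid is offset by half a cell. Its values
    at the two ghost points therefore equal those at the end points ([b0] and [bN]), and the
    boundary rows reduce to the interior one. *)
Lemma AN_phiN j i : (i < N)%N -> AN N (phiN R N j) i = - lamN R N j * phiN R N j i.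
Proof.
move=> iN; rewrite /AN /lamN.
set t := j%:R * hN R N.
have e0 : j%:R * pi / (2 * N%:R) = t / 2 :> R.
  by rewrite /t /hN; field.
have e1 : cos t = 1 - 2 * sin (t / 2) ^+ 2.
  have {1}-> : t = (t / 2) *+ 2 by rewrite mulr2n; lra.
  by rewrite cos_mulr2n cos2sin2 mulr2n; ring.
have eu k : cos (j%:R * xN R N k.+1) = cos (j%:R * xN R N k + t).
  by congr cos; rewrite /t /xN -natr1; ring.
have ed k : cos (j%:R * xN R N k) = cos (j%:R * xN R N k.+1 - t).
  by congr cos; rewrite /t /xN -natr1; ring.
have b0 : cos (j%:R * xN R N 0) = cos (j%:R * xN R N 0 - t).
  by rewrite -cosN; congr cos; rewrite /t /xN; field.
have bN : cos (j%:R * xN R N N.-1 + t) = cos (j%:R * xN R N N.-1).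
  have xx : xN R N N.-1 = pi - hN R N / 2.
    rewrite /xN -[X in X - _]hNN -subn1 natrB ?(ltnW N2) //; by field.
  have -> : j%:R * xN R N N.-1 + t = j%:R * pi + t / 2 by rewrite xx /t; field.
  have -> : j%:R * xN R N N.-1 = j%:R * pi - t / 2 by rewrite xx /t; field.
  by rewrite cosD cosB sin_natpi !mul0r subr0 addr0.
have key x : cos (x - t) - 2 * cos x + cos (x + t) = - (4 * sin (t / 2) ^+ 2) * cos x.
  rewrite cosB cosD e1; ring.
rewrite e0 /phiN !phiE.
set K := N%:R ^+ 2 / pi ^+ 2.
transitivity (K * (phi_scale j * (cos (j%:R * xN R N i - t) - 2 * cos (j%:R * xN R N i) + cos (j%:R * xN R N i + t))));
  last first.
  by rewrite key /K; ring.
congr (_ * _).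
case: i iN => [|i] iN /=.
  rewrite ifF; last by lia.
  by rewrite -b0 eu; ring.
rewrite (ed i); case: eqP => [E|_]; last by rewrite (eu i.+1); ring.
by rewrite E bN; ring.
Qed.

Lemma coef_AN (u : vec R) j : coef (AN N u) j = - lamN R N j * coef u j.
Proof.
rewrite /coef l2ip_AN dformC -l2ip_AN.
rewrite (@eq_l2ip _ (fun i => - lamN R N j * phiN R N j i) u u) //; last exact: AN_phiN.
rewrite [RHS](_ : _ = - lamN R N j * l2ip N (phiN R N j) u); last by rewrite l2ipC.
rewrite /l2ip [RHS]mulrCA; congr (_ * _); rewrite mulr_sumr; apply: eq_bigr => i _.
by rewrite mulrA.
Qed.

Lemma dform_coef (u v : vec R) :
  dform u v = \sum_(j < N) lamN R N j * coef u j * coef v j.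
Proof.
rewrite -[LHS]opprK -l2ip_AN parseval -sumrN; apply: eq_bigr => j _.
by rewrite coef_AN !mulNr opprK.
Qed.

Lemma lamN_ge0 j : 0 <= lamN R N j.
Proof.
by rewrite /lamN mulr_ge0 ?sqr_ge0 // divr_ge0 ?sqr_ge0 // mulr_ge0 ?sqr_ge0.
Qed.

Lemma lamN0 : lamN R N 0 = 0.
Proof. by rewrite /lamN !mul0r sin0 expr0n mulr0. Qed.

Lemma lamN_ge j : (j < N)%N -> j%:R ^+ 2 / 4 <= lamN R N j.
Proof.
move=> jN; have ppi := pi_gt0 R; have pn0 : (pi : R) != 0 by rewrite gt_eqF.
pose x : R := j%:R * pi / (2 * N%:R).
have x0 : 0 <= x by rewrite divr_ge0 // mulr_ge0 // ltW.
have x1 : x <= pi / 2.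
  have -> : x = (j%:R / N%:R) * (pi / 2) by rewrite /x; field.
  rewrite ler_piMl ?ler_pdivrMr ?divr_ge0 ?mul1r ?ler_nat //; first exact: ltW.
  exact: ltnW.
have h := half_le_sin (introT andP (conj x0 x1)).
have E : j%:R ^+ 2 / 4 = 4 * N%:R ^+ 2 / pi ^+ 2 * (x / 2) ^+ 2.
  by rewrite /x; move: (pi : R) pn0 => q pn0; field; rewrite pn0 Nn0.
rewrite E /lamN -/x; apply: ler_wpM2l.
  by rewrite divr_ge0 ?sqr_ge0 // mulr_ge0 ?sqr_ge0.
by rewrite lerXn2r // nnegrE; lra.
Qed.

Lemma lamN_gap j : (0 < j < N)%N -> 1 / 4 <= lamN R N j.
Proof.
move=> /andP[j0 jN]; apply: le_trans (lamN_ge jN).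
by rewrite ler_pM2r // exprn_ege1 // ler1n.
Qed.

Lemma lamN_gt0 j : (0 < j < N)%N -> 0 < lamN R N j.
Proof. by move=> /lamN_gap; apply: lt_le_trans; rewrite divr_gt0. Qed.

Lemma coef_semigN t (v : vec R) j : (j < N)%N ->
  coef (semigN N t v) j = expR (- lamN R N j ^+ 2 * t) * coef v j.
Proof.
exact: (@coef_syn (fun j => expR (- lamN R N j ^+ 2 * t) * coef v j)).
Qed.

Lemma w12normE (v : vec R) :
  w12norm N v ^+ 2 = \sum_(j < N) (1 + lamN R N j) * coef v j ^+ 2.
Proof.
have ip0 (u : vec R) : 0 <= l2ip N u u.
  by rewrite mulr_ge0 ?(ltW hN_gt0) // sumr_ge0 // => i _; rewrite -expr2 sqr_ge0.
rewrite /w12norm sqr_sqrtr ?addr_ge0 ?sqr_ge0 // /l2norm !sqr_sqrtr //.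
rewrite !parseval -big_split; apply: eq_bigr => j _ /=.
rewrite (@coef_syn (fun j => Num.sqrt (lamN R N j) * coef v j)) //.
have := sqr_sqrtr (lamN_ge0 j); set w := Num.sqrt _; set c := coef _ _ => <-; ring.
Qed.

End CosineBasis.

(** * Convexity inequalities for weighted sums *)

Section FiniteSums.
Variable R : realType.

(** Expansion of the nonnegative double sum of [w i * w j * ((x i - x j) * (z i - z j))]. With
    [z = x] it gives Cauchy-Schwarz, with [z] a power of [x] the induction step of Jensen. *)
Lemma chebyshev_sum n (w x z : 'I_n -> R) :
  (forall i, 0 <= w i) -> (forall i j, 0 <= (x i - x j) * (z i - z j)) ->
  (\sum_i w i * x i) * (\sum_i w i * z i) <= (\sum_i w i) * (\sum_i w i * (x i * z i)).
Proof.
move=> w0 xz.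
have : 0 <= \sum_i \sum_j w i * w j * ((x i - x j) * (z i - z j)).
  by apply: sumr_ge0 => i _; apply: sumr_ge0 => j _; rewrite mulr_ge0 // mulr_ge0.
pose S (a b : 'I_n -> R) : R := (\sum_i a i) * (\sum_i b i).
have SE (a b : 'I_n -> R) : \sum_i \sum_j a i * b j = S a b.
  by rewrite /S mulr_suml; apply: eq_bigr => i _; rewrite mulr_sumr.
have -> : \sum_i \sum_j w i * w j * ((x i - x j) * (z i - z j)) =
  \sum_i \sum_j ((w i * (x i * z i)) * w j) + \sum_i \sum_j (w i * (w j * (x j * z j)))
  - (\sum_i \sum_j (w i * x i) * (w j * z j) + \sum_i \sum_j (w i * z i) * (w j * x j)).
  rewrite -!big_split -sumrB /=; apply: eq_bigr => i _.
  rewrite -!big_split -sumrB /=; apply: eq_bigr => j _; ring.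
rewrite !SE /S.
set A := \sum_i w i * x i; set B := \sum_i w i * z i.
set C := \sum_i w i; set D := \sum_i w i * (x i * z i); lra.
Qed.

Lemma jensen_pow n (w x : 'I_n -> R) Q : (forall i, 0 <= w i) -> (forall i, 0 <= x i) ->
  (\sum_i w i * x i) ^+ Q.+1 <= (\sum_i w i) ^+ Q * \sum_i w i * x i ^+ Q.+1.
Proof.
move=> w0 x0; elim: Q => [|Q IH]; first by rewrite expr0 mul1r expr1; under [leRHS]eq_bigr do rewrite expr1.
have s0 : 0 <= \sum_i w i * x i by apply: sumr_ge0 => i _; rewrite mulr_ge0.
have W0 : 0 <= \sum_i w i by apply: sumr_ge0 => i _.
rewrite exprS; apply: le_trans (ler_wpM2l s0 IH) _.
rewrite mulrCA exprSr -mulrA; apply: ler_wpM2l; first exact: exprn_ge0.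
under [X in _ <= _ * X]eq_bigr do rewrite exprS.
apply: chebyshev_sum => // i j.
have [ij|/ltW ji] := leP (x i) (x j).
  by rewrite mulr_le0 // subr_le0 // lerXn2r // nnegrE.
by rewrite mulr_ge0 // subr_ge0 // lerXn2r // nnegrE.
Qed.

Lemma jensen_sqr n (w x : 'I_n -> R) : (forall i, 0 <= w i) ->
  (\sum_i w i * x i) ^+ 2 <= (\sum_i w i) * \sum_i w i * x i ^+ 2.
Proof.
move=> w0; rewrite !expr2.
under [X in _ <= _ * X]eq_bigr do rewrite expr2.
by apply: chebyshev_sum => // i j; rewrite -expr2 sqr_ge0.
Qed.

Lemma convex_pow (t a b : R) Q : 0 <= t <= 1 -> 0 <= a -> 0 <= b ->
  ((1 - t) * a + t * b) ^+ Q.+1 <= (1 - t) * a ^+ Q.+1 + t * b ^+ Q.+1.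
Proof.
move=> /andP[t0 t1] a0 b0.
pose w (i : 'I_2) := if i == ord0 then 1 - t else t.
pose x (i : 'I_2) := if i == ord0 then a else b.
have := @jensen_pow 2 w x Q.
rewrite !big_ord_recl !big_ord0 /w /x /= !addr0 subrK expr1n mul1r; apply.
  by move=> i; case: ifP => _ //; rewrite subr_ge0.
by move=> i; case: ifP.
Qed.

Lemma powD_le (a b : R) Q : 0 <= a -> 0 <= b ->
  (a + b) ^+ Q <= 2 ^+ Q * (a ^+ Q + b ^+ Q).
Proof.
move=> a0 b0; case: Q => [|Q]; first by rewrite !expr0; lra.
have h : 0 <= (2^-1 : R) <= 1 by apply/andP; split; lra.
have := convex_pow Q h a0 b0.
have -> : (1 - 2^-1) * a + 2^-1 * b = 2^-1 * (a + b) by lra.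
rewrite exprMn exprVn ler_pdivrMl ?exprn_gt0 //.
move=> /le_trans; apply; apply: ler_wpM2l; first exact: exprn_ge0.
have := exprn_ge0 Q.+1 a0; have := exprn_ge0 Q.+1 b0; lra.
Qed.

(** The induction is run on the stronger bound [2 - 1/n] for [n] terms. *)
Lemma sum_inv_sqr n : \sum_(j < n) (j.+1%:R ^+ 2)^-1 <= 2 :> R.
Proof.
case: n => [|n]; first by rewrite big_ord0.
suff : \sum_(j < n.+1) (j.+1%:R ^+ 2)^-1 <= 2 - n.+1%:R^-1 :> R.
  by move=> /le_trans; apply; rewrite gerBl invr_ge0.
elim: n => [|n IH]; first by rewrite big_ord_recl big_ord0 expr1n invr1; lra.
rewrite big_ord_recr /=; apply: le_trans (lerD IH (lexx _)) _.
have n0 : (0 : R) < n.+1%:R by [].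
rewrite -[n.+2%:R]natr1; set k : R := n.+1%:R in n0 *.
have k1 : 0 < k + 1 by lra.
rewrite -subr_ge0.
have -> : 2 - (k + 1)^-1 - (2 - k^-1 + ((k + 1) ^+ 2)^-1) = (k * (k + 1) ^+ 2)^-1.
  by field; rewrite !gt_eqF.
by rewrite invr_ge0 mulr_ge0 ?sqr_ge0 // ltW.
Qed.

Lemma total_variation (f : nat -> R) n i k : (i <= n)%N -> (k <= n)%N ->
  `|f k - f i| <= \sum_(l < n) `|f l.+1 - f l|.
Proof.
wlog ik : i k / (i <= k)%N.
  move=> H iN kN; have [ik|/ltnW ki] := leqP i k; first exact: H.
  by rewrite distrC; exact: H.
move=> _ kn; rewrite -telescope_sumr //.
apply: le_trans (ler_norm_sum _ _ _) _.
rewrite -(big_mkord xpredT (fun l => `|f l.+1 - f l|)).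
rewrite (big_cat_nat (leq0n i) (leq_trans ik kn)) /=.
rewrite (big_cat_nat ik kn) /= addrCA lerDl addr_ge0 // sumr_ge0 // => j _; exact: normr_ge0.
Qed.

End FiniteSums.

(** * Discrete Sobolev and interpolation inequalities *)

Section GridInequalities.
Variables (R : realType) (N : nat).
Hypothesis N2 : (2 <= N)%N.

Local Notation lam := (lamN R N).
Local Notation h := (hN R N).

Definition w12sq (a : nat -> R) := \sum_(j < N) (1 + lam j) * a j ^+ 2.
Definition l2sq (a : nat -> R) := \sum_(j < N) a j ^+ 2.
Definition gradsq (a : nat -> R) := \sum_(j < N) lam j * a j ^+ 2.

Lemma l2sq_ge0 a : 0 <= l2sq a.
Proof. by apply: sumr_ge0 => j _; exact: sqr_ge0. Qed.

Lemma gradsq_ge0 a : 0 <= gradsq a.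
Proof. by apply: sumr_ge0 => j _; rewrite mulr_ge0 ?lamN_ge0 ?sqr_ge0. Qed.

Lemma w12sqE a : w12sq a = l2sq a + gradsq a.
Proof. by rewrite -big_split; apply: eq_bigr => j _; rewrite mulrDl mul1r. Qed.

Lemma w12sq_ge0 a : 0 <= w12sq a.
Proof. by rewrite w12sqE addr_ge0 ?l2sq_ge0 ?gradsq_ge0. Qed.

Lemma w12sq_half a b c : (forall j, (j < N)%N -> a j ^+ 2 <= 2 * b j ^+ 2 + 2 * c j ^+ 2) ->
  w12sq a <= 2 * w12sq b + 2 * w12sq c.
Proof.
move=> H; rewrite /w12sq !mulr_sumr -big_split; apply: ler_sum => j _ /=.
have /(ler_wpM2l) := H j (ltn_ord j).
have l0 : 0 <= 1 + lam j by have := lamN_ge0 R N j; lra.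
move=> /(_ _ l0) /le_trans; apply; lra.
Qed.

Lemma l2ip_synE a : l2ip N (syn N a) (syn N a) = l2sq a.
Proof.
by rewrite (parseval N2); apply: eq_bigr => j _; rewrite coef_syn // expr2.
Qed.

Lemma dform_synE a : dform N (syn N a) (syn N a) = gradsq a.
Proof.
by rewrite (dform_coef N2); apply: eq_bigr => j _; rewrite coef_syn // expr2 mulrA.
Qed.

Lemma sum_inv_lamN : \sum_(j < N) (lam j)^-1 <= 8.
Proof.
(* Mode [0] contributes nothing, since the inverse of [lamN R N 0 = 0] is [0] by convention. *)
case: N N2 => [//|n] n2; rewrite big_ord_recl /= lamN0 invr0 add0r.
apply: (@le_trans _ _ (\sum_(j < n) 4 * (j.+1%:R ^+ 2)^-1)).
  apply: ler_sum => j _; rewrite /bump /= add1n.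
  rewrite -[leRHS]invf_div lef_pV2 ?posrE.
  - by apply: lamN_ge => //; rewrite ltnS.
  - by apply: lamN_gt0 => //=; rewrite ltnS.
  - by rewrite mulr_gt0 ?invr_gt0 ?exprn_gt0.
rewrite -mulr_sumr; have := sum_inv_sqr R n; lra.
Qed.

Lemma sum_inv_1lamN : \sum_(j < N) (1 + lam j)^-1 <= 9.
Proof.
apply: (@le_trans _ _ (1 + \sum_(j < N) (lam j)^-1)); last by have := sum_inv_lamN; lra.
case: N N2 => [//|n] n2; rewrite !big_ord_recl /= lamN0 invr0 addr0 invr1 lerD2l add0r.
apply: ler_sum => j _; rewrite /bump /= add1n.
have l0 : 0 < lamN R n.+1 j.+1.
  by apply: lamN_gt0 => //=; rewrite ltnS.
rewrite lef_pV2 ?posrE //; lra.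
Qed.

(** Cauchy-Schwarz with the weights [1 / (1 + lam j)], whose sum is at most [9], and basis functions
    bounded by [1]. *)
Lemma sup_w12 a i : (syn N a i) ^+ 2 <= 9 * w12sq a.
Proof.
have l0 j : 0 < 1 + lam j by have := lamN_ge0 R N j; lra.
have -> : syn N a i = \sum_(j < N) (1 + lam j)^-1 * ((1 + lam j) * (a j * phiN R N j i)).
  by apply: eq_bigr => j _; rewrite mulKf // gt_eqF.
apply: le_trans (jensen_sqr _ _) _; first by move=> j; rewrite invr_ge0 ltW.
apply: ler_pM.
- by apply: sumr_ge0 => j _; rewrite invr_ge0 ltW.
- by apply: sumr_ge0 => j _; rewrite mulr_ge0 ?sqr_ge0 // invr_ge0 ltW.
- exact: sum_inv_1lamN.
apply: ler_sum => j _.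
have -> : (1 + lam j)^-1 * ((1 + lam j) * (a j * phiN R N j i)) ^+ 2 =
   (1 + lam j) * a j ^+ 2 * phiN R N j i ^+ 2.
  by field; rewrite gt_eqF.
apply: ler_piMr; first by rewrite mulr_ge0 ?sqr_ge0 // ltW.
rewrite -real_normK ?num_real // expr_le1 //; exact: norm_phi_le1.
Qed.

Lemma sum_syn_eq0 (a : nat -> R) : a 0%N = 0 -> \sum_(i < N) syn N a i = 0.
Proof.
move=> a00; have N0 : (0 < N)%N by exact: ltnW.
have := @coef_syn R N N2 a 0 N0; rewrite a00 /coef /l2ip.
under eq_bigr do rewrite /phiN /phi eqxx.
rewrite -mulr_suml => /eqP; rewrite mulf_eq0 gt_eqF ?hN_gt0 //= mulf_eq0 invr_eq0.
by case/orP => [/eqP //|]; rewrite gt_eqF // sqrtr_gt0 pi_gt0.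
Qed.

(** An upper bound for the total variation of [v * |v|] along the grid, the discrete counterpart of
    the integral of [2 |v| |v'|]. *)
Definition varsq (v : vec R) :=
  \sum_(l < N.-1) (`|v l| + `|v l.+1|) * `|v l.+1 - v l|.

Lemma varsq_ge0 v : 0 <= varsq v.
Proof. by apply: sumr_ge0 => l _; rewrite mulr_ge0 // addr_ge0. Qed.

(* [x * |x|] is monotone and vanishes where [v] changes sign. *)
Lemma sup_varsq (v : vec R) i : \sum_(i < N) v i = 0 -> (i < N)%N -> v i ^+ 2 <= varsq v.
Proof.
move=> v0 iN; pose psi (x : R) := x * `|x|.
have N0 : (0 < N)%N by exact: ltnW.
have psiL (x y : R) : `|psi y - psi x| <= (`|x| + `|y|) * `|y - x|.
  have -> : psi y - psi x = y * (`|y| - `|x|) + (y - x) * `|x| by rewrite /psi; ring.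
  apply: le_trans (ler_normD _ _) _; rewrite !normrM normr_id.
  have := ler_wpM2l (normr_ge0 y) (lerB_dist y x).
  have := ler_wpM2l (normr_ge0 y) (lerB_dist x y); rewrite distrC => h1 h2.
  have : `|y| * `| `|y| - `|x| | <= `|y| * `|y - x|.
    by apply: ler_wpM2l => //; exact: ler_dist_dist.
  lra.
have var k : (k < N)%N -> `|psi (v i) - psi (v k)| <= varsq v.
  move=> kN; have := @total_variation R (psi \o v) N.-1 k i.
  have -> : (k <= N.-1)%N by rewrite -ltnS prednK.
  have -> : (i <= N.-1)%N by rewrite -ltnS prednK.
  move=> /(_ isT isT) /le_trans; apply.
  by apply: ler_sum => l _; exact: psiL.
have key (sg : bool) : exists2 k, (k < N)%N & 0 <= (-1) ^+ sg * v k.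
  apply: contrapT => H.
  have neg (k : 'I_N) : (-1) ^+ sg * v k < 0.
    by rewrite ltNge; apply/negP => vk; apply: H; exists k.
  have : \sum_(k < N) (-1) ^+ sg * v k < 0.
    rewrite (bigD1 (Ordinal N0)) //=.
    have := neg (Ordinal N0); rewrite /= => h1.
    have : \sum_(k < N | k != Ordinal N0) (-1) ^+ sg * v k <= 0.
      by apply: sumr_le0 => k _; exact: ltW.
    lra.
  by rewrite -mulr_sumr v0 mulr0 ltxx.
have [vi|/ltW vi] := leP 0 (v i).
  have [k kN] := key true; rewrite expr1 mulN1r oppr_ge0 => vk.
  apply: le_trans (var k kN); apply: le_trans (ler_norm _).
  rewrite /psi ger0_norm // ler0_norm // mulrN opprK expr2 lerDl -expr2; exact: sqr_ge0.
have [k kN] := key false; rewrite expr0 mul1r => vk.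
apply: le_trans (var k kN); rewrite distrC; apply: le_trans (ler_norm _).
rewrite /psi (ger0_norm vk) (ler0_norm vi) mulrN opprK expr2 lerDr -expr2; exact: sqr_ge0.
Qed.

(** The discrete counterpart of the integral of [2 v^2 |v'|^2], the quantity that the leading cubic
    term makes available. By the next lemma it dominates [varsq v ^+ 2], hence the fourth power of
    the maximum of a mean-zero [v]. *)
Definition quart (v : vec R) :=
  h^-1 * \sum_(l < N.-1) (v l ^+ 2 + v l.+1 ^+ 2) * (v l.+1 - v l) ^+ 2.

Lemma varsq_quart v : varsq v ^+ 2 <= 2 * pi * quart v.
Proof.
have h0 := hN_gt0 R N2.
have := @jensen_sqr R N.-1 (fun=> 1) (fun l => (`|v l| + `|v l.+1|) * `|v l.+1 - v l|) (fun _ => ler01).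
under eq_bigr do rewrite mul1r.
under [X in _ * X]eq_bigr do rewrite mul1r.
rewrite sumr_const card_ord => /le_trans; apply.
have -> : 2 * pi * quart v = N%:R * \sum_(l < N.-1) 2 * ((v l ^+ 2 + v l.+1 ^+ 2) * (v l.+1 - v l) ^+ 2).
  by rewrite /quart -(hNN R N2) -mulr_sumr; move: (\sum_(_ < _) _) => S; field; rewrite gt_eqF.
apply: ler_pM => //.
- by apply: sumr_ge0 => l _; exact: sqr_ge0.
- by rewrite ler_nat leq_pred.
apply: ler_sum => l _; rewrite exprMn real_normK ?num_real // mulrA.
apply: ler_wpM2r; first exact: sqr_ge0.
rewrite -(real_normK (num_real (v l))) -(real_normK (num_real (v l.+1))).
have := sqr_ge0 (`|v l| - `|v l.+1|); rewrite sqrrB sqrrD; lra.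
Qed.

(** The inequality [|v|_oo^2 <= 2 |v| |v'|] in Young form. The parameter [s] stays free so that the
    gradient can later receive an arbitrarily small coefficient. *)
Lemma varsq_young (s : R) v : 0 < s ->
  varsq v <= 2 * s * l2ip N v v + (2 * s)^-1 * dform N v v.
Proof.
move=> s0; have h0 := hN_gt0 R N2.
pose t := s * h; have t0 : 0 < t by rewrite mulr_gt0.
have E1 : 2 * s * l2ip N v v = t * (\sum_(l < N) v l ^+ 2 + \sum_(l < N) v l ^+ 2).
  rewrite /l2ip /t; under eq_bigr do rewrite -expr2; ring.
have E2 : (2 * s)^-1 * dform N v v = (2 * t)^-1 * \sum_(l < N.-1) (v l.+1 - v l) ^+ 2.
  rewrite /dform /t; under eq_bigr do rewrite -expr2.
  by field; rewrite !gt_eqF.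
have S1 : \sum_(l < N.-1) v l ^+ 2 <= \sum_(l < N) v l ^+ 2.
  by case: N N2 => [//|n] _ /=; rewrite big_ord_recr /= lerDl sqr_ge0.
have S2 : \sum_(l < N.-1) v l.+1 ^+ 2 <= \sum_(l < N) v l ^+ 2.
  case: N N2 => [//|n] _ /=; rewrite big_ord_recl /=.
  by rewrite (eq_bigr (fun l : 'I_n => v l.+1 ^+ 2)) ?lerDr ?sqr_ge0 // => l _; rewrite lift0.
rewrite E1 E2.
apply: (@le_trans _ _ (t * (\sum_(l < N.-1) v l ^+ 2 + \sum_(l < N.-1) v l.+1 ^+ 2) +
   (2 * t)^-1 * \sum_(l < N.-1) (v l.+1 - v l) ^+ 2)).
  rewrite -big_split !mulr_sumr -big_split; apply: ler_sum => l _ /=.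
  rewrite -(real_normK (num_real (v l))) -(real_normK (num_real (v l.+1))) -(real_normK (num_real (v l.+1 - v l))).
  move: `|v l| `|v l.+1| `|v l.+1 - v l| => a b c.
  rewrite -subr_ge0.
  have -> : t * (a ^+ 2 + b ^+ 2) + (2 * t)^-1 * c ^+ 2 - (a + b) * c =
     (2 * t)^-1 * ((c - t * (a + b)) ^+ 2 + (t * (a - b)) ^+ 2).
    by field; rewrite gt_eqF.
  by rewrite mulr_ge0 ?invr_ge0 ?addr_ge0 ?sqr_ge0 // mulr_ge0 // ltW.
rewrite lerD2r; apply: ler_wpM2l; [exact: ltW|exact: lerD].
Qed.

End GridInequalities.

(** * Growth and coercivity of the cubic *)

Section CubicBounds.
Variables (R : realType) (a0 a1 a2 a3 : R).
Hypothesis a0_gt0 : 0 < a0.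

Local Notation F := (fcub a0 a1 a2 a3).

(** The divided difference of the cubic, in polynomial form so that coincident points need no
    separate case. *)
Definition slope (a b : R) := a0 * (a ^+ 2 + a * b + b ^+ 2) + a1 * (a + b) + a2.

Lemma fcubB a b : F b - F a = slope a b * (b - a).
Proof. rewrite /fcub /slope; ring. Qed.

Definition slope_ub := 2 * a0 + `|a1| + `|a2|.

Lemma slope_ub_gt0 : 0 < slope_ub.
Proof. have := normr_ge0 a1; have := normr_ge0 a2; have := a0_gt0; rewrite /slope_ub; lra. Qed.

Lemma slope_norm a b : `|slope a b| <= slope_ub * (1 + a ^+ 2 + b ^+ 2).
Proof.
have ab1 := sqr_ge0 (a + b); have ab2 := sqr_ge0 (a - b); rewrite sqrrD in ab1; rewrite sqrrB in ab2.
have a1p := sqr_ge0 (a + 1 / 2); have b1p := sqr_ge0 (b + 1 / 2); rewrite sqrrD in a1p; rewrite sqrrD in b1p.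
have a1m := sqr_ge0 (a - 1 / 2); have b1m := sqr_ge0 (b - 1 / 2); rewrite sqrrB in a1m; rewrite sqrrB in b1m.
apply: le_trans (ler_normD _ _) _; rewrite /slope_ub 2!(mulrDl _ _ (1 + _ + _)); apply: lerD; last first.
  apply: ler_peMr => //; have := sqr_ge0 a; have := sqr_ge0 b; lra.
apply: le_trans (ler_normD _ _) _; apply: lerD.
  rewrite normrM gtr0_norm // [2 * a0]mulrC -mulrA; apply: ler_wpM2l; first exact: ltW.
  rewrite ler_norml; apply/andP; split; lra.
rewrite normrM; apply: ler_wpM2l => //.
rewrite ler_norml; apply/andP; split; lra.
Qed.

Lemma slope_sqr a b M : a ^+ 2 <= M -> b ^+ 2 <= M ->
  slope a b ^+ 2 <= slope_ub ^+ 2 * (1 + 2 * M) ^+ 2.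
Proof.
move=> aM bM; rewrite -exprMn -[leLHS]real_normK ?num_real // lerXn2r ?nnegrE //.
  by rewrite mulr_ge0 ?(ltW slope_ub_gt0) //; have := sqr_ge0 a; lra.
apply: le_trans (slope_norm a b) _; rewrite ler_pM2l ?slope_ub_gt0 //; lra.
Qed.

Definition slope_lb := `|a2| + 2 * a1 ^+ 2 / a0.

Lemma slope_lb_ge0 : 0 <= slope_lb.
Proof. by rewrite addr_ge0 // divr_ge0 ?(ltW a0_gt0) // mulr_ge0 ?sqr_ge0. Qed.

(** Since [a^2 + a b + b^2] is [(a^2 + b^2) / 2] plus [(a + b)^2 / 2], the leading part is at least
    [a0 / 2 * (a^2 + b^2)]. Half of that absorbs [a1 * (a + b)] by completing the square in each
    variable, at the cost [a1^2 / a0] each. *)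
Lemma slope_lower a b : a0 / 4 * (a ^+ 2 + b ^+ 2) - slope_lb <= slope a b.
Proof.
have sq x : 0 <= a0 / 4 * x ^+ 2 + a1 * x + a1 ^+ 2 / a0.
  have -> : a0 / 4 * x ^+ 2 + a1 * x + a1 ^+ 2 / a0 = a0 / 4 * (x + 2 * a1 / a0) ^+ 2.
    by field; rewrite gt_eqF.
  by rewrite mulr_ge0 ?sqr_ge0 // divr_ge0 // ltW.
have h1 := sq a; have h2 := sq b.
have h3 : - `|a2| <= a2 by rewrite lerNl -normrN ler_norm.
have h4 : 0 <= a0 * ((a + b) ^+ 2 / 2) by rewrite mulr_ge0 ?(ltW a0_gt0) // divr_ge0 ?sqr_ge0.
rewrite /slope /slope_lb -[2 * _ / a0]mulrA; set w := a1 ^+ 2 / a0 in h1 h2 *; nra.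
Qed.

Definition drift_cst := slope_lb + a0 / 8 + 2 * slope_ub ^+ 2 / a0.

Lemma drift_cst_ge0 : 0 <= drift_cst.
Proof.
rewrite /drift_cst; have := slope_lb_ge0; have := a0_gt0 => h1 h2.
have : 0 <= 2 * slope_ub ^+ 2 / a0 by rewrite divr_ge0 ?(ltW a0_gt0) // mulr_ge0 ?sqr_ge0.
lra.
Qed.

(** In use, [p] and [r] are the increments of [Yt] and [O] over one grid cell, and [a], [b] are the
    values of [Yt + O] at its ends. Half of the coercivity [a0 / 4] pays for the cross term [p * r]
    by Young. In [drift_cst], [2 * slope_ub^2 / a0] is the Young constant and [a0 / 8] comes from
    the [1] in [1 + a^2 + b^2]. *)
Lemma slope_drift a b p r :
  - (slope a b * p * (p + r)) <= - (a0 / 8) * (a ^+ 2 + b ^+ 2) * p ^+ 2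
     + drift_cst * p ^+ 2 + drift_cst * (1 + a ^+ 2 + b ^+ 2) * r ^+ 2.
Proof.
set S := 1 + a ^+ 2 + b ^+ 2.
have S1 : 1 <= S by rewrite /S; have := sqr_ge0 a; have := sqr_ge0 b; lra.
have cross : - (slope a b * p * r) <= S * (a0 / 8 * p ^+ 2 + 2 * slope_ub ^+ 2 / a0 * r ^+ 2).
  apply: (@le_trans _ _ (slope_ub * S * (`|p| * `|r|))).
    apply: le_trans (ler_norm _) _; rewrite normrN !normrM -mulrA.
    by apply: ler_wpM2r; [rewrite mulr_ge0|exact: slope_norm].
  rewrite -mulrA mulrCA; apply: ler_wpM2l; first lra.
  rewrite -(real_normK (num_real p)) -(real_normK (num_real r)) -subr_ge0.
  move: `|p| `|r| => x y.
  have -> : a0 / 8 * x ^+ 2 + 2 * slope_ub ^+ 2 / a0 * y ^+ 2 - slope_ub * (x * y) =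
     a0 / 8 * (x - 4 * slope_ub / a0 * y) ^+ 2 by field; rewrite gt_eqF.
  by rewrite mulr_ge0 ?sqr_ge0 // divr_ge0 // ltW.
have low := ler_wpM2r (sqr_ge0 p) (slope_lower a b).
have r2 := sqr_ge0 r; have p2 := sqr_ge0 p.
have c0 := slope_lb_ge0.
set k := 2 * slope_ub ^+ 2 / a0 in cross *.
have k0 : 0 <= k by rewrite divr_ge0 ?(ltW a0_gt0) // mulr_ge0 ?sqr_ge0.
have e1 : drift_cst * S * r ^+ 2 >= k * S * r ^+ 2.
  rewrite -subr_ge0 (_ : _ - _ = (slope_lb + a0 / 8) * (S * r ^+ 2)); last by rewrite /drift_cst -/k; ring.
  rewrite mulr_ge0 //; last by rewrite mulr_ge0 //; lra.
  have := a0_gt0; lra.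
have e2 : drift_cst * p ^+ 2 >= (slope_lb + a0 / 8) * p ^+ 2.
  by apply: ler_wpM2r => //; rewrite /drift_cst -/k lerDl.
rewrite /S in cross e1 *; nra.
Qed.

Definition growth_cst := 4 * (a0 ^+ 2 + a1 ^+ 2 + a2 ^+ 2 + a3 ^+ 2).

Lemma growth_cst_gt0 : 0 < growth_cst.
Proof.
rewrite /growth_cst; have := sqr_ge0 a1; have := sqr_ge0 a2; have := sqr_ge0 a3.
have : 0 < a0 ^+ 2 by rewrite exprn_gt0.
lra.
Qed.

Lemma fcub_sqr x : F x ^+ 2 <= growth_cst * (1 + x ^+ 2) ^+ 3.
Proof.
have e (p q r s : R) : (p + q + r + s) ^+ 2 <= 4 * (p ^+ 2 + q ^+ 2 + r ^+ 2 + s ^+ 2).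
  have := sqr_ge0 (p - q); have := sqr_ge0 (p - r); have := sqr_ge0 (p - s).
  have := sqr_ge0 (q - r); have := sqr_ge0 (q - s); have := sqr_ge0 (r - s); nra.
apply: le_trans (e _ _ _ _) _; rewrite /growth_cst -mulrA ler_pM2l // !mulrDl.
have x2 := sqr_ge0 x; set t := x ^+ 2 in x2 *.
have E1 : (a0 * x ^+ 3) ^+ 2 = a0 ^+ 2 * t ^+ 3 by rewrite /t; ring.
have E2 : (a1 * t) ^+ 2 = a1 ^+ 2 * t ^+ 2 by ring.
have E3 : (a2 * x) ^+ 2 = a2 ^+ 2 * t by rewrite /t; ring.
have b1 : t ^+ 3 <= (1 + t) ^+ 3 by rewrite lerXn2r ?nnegrE; lra.
have b2 : t ^+ 2 <= (1 + t) ^+ 3 by nra.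
have b3 : t <= (1 + t) ^+ 3 by nra.
have b4 : 1 <= (1 + t) ^+ 3 by nra.
rewrite E1 E2 E3; apply: lerD; [apply: lerD; [apply: lerD|]|].
- by apply: ler_wpM2l b1; exact: sqr_ge0.
- by apply: ler_wpM2l b2; exact: sqr_ge0.
- by apply: ler_wpM2l b3; exact: sqr_ge0.
- by rewrite -[leLHS]mulr1; apply: ler_wpM2l b4; exact: sqr_ge0.
Qed.

End CubicBounds.

(** * The one-step decay factor of a single mode *)

Section ExpBounds.
Variable R : realType.

(** Everything follows from [1 - 2 x <= e^2 <= 1 / (1 + 2 x)] with [x = l^2 * tau = (l * s)^2]. The
    second claim tames the quadratic term of the step, the third compares [tau |A Yt|^2] with the
    dissipation, the fourth is the price of exchanging [Y] for [Yt], and the last is the decay given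
    by the spectral gap: [x >= tau / 16] and [tau < 1] yield [tau / 9]. *)
Lemma expR_step (l tau s : R) (e := expR (- l ^+ 2 * tau)) :
  0 <= l -> 0 < tau < 1 -> 0 <= s -> s ^+ 2 = tau ->
  [/\ 0 < e <= 1, l * e ^+ 2 * s <= 1, tau * l ^+ 2 * e ^+ 4 <= 1 - e ^+ 2,
      (1 - e ^+ 2) ^+ 2 <= 2 * l * s & (1 / 4 <= l -> tau / 9 <= 1 - e ^+ 2)].
Proof.
move=> l0 /andP[t0 t1] s0 st.
pose x := l ^+ 2 * tau; pose z := l * s.
have x0 : 0 <= x by rewrite mulr_ge0 ?sqr_ge0 // ltW.
have z0 : 0 <= z by rewrite mulr_ge0.
have xz : x = z ^+ 2 by rewrite /x /z -st; ring.
have e0 : 0 < e := expR_gt0 _.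
have e1 : e <= 1 by rewrite expR_le1 mulNr oppr_le0.
pose w := e ^+ 2.
have wE : w = expR (- (2 * x)).
  by rewrite /w /e -expRM_natl /x; congr expR; ring.
have w0 : 0 < w by rewrite wE expR_gt0.
have w1 : w <= 1 by rewrite /w expr_le1 // ltW.
have wx : w * (1 + 2 * x) <= 1.
  rewrite wE -[leRHS](expRxMexpNx_1 (- (2 * x))) opprK ler_wpM2l ?expR_ge0 //.
  exact: expR_ge1Dx.
have wl : 1 - 2 * x <= w by rewrite wE; exact: expR_ge1Dx.
have w4 : e ^+ 4 = w ^+ 2 by rewrite /w -exprM.
split; rewrite -?/w ?w4.
- by rewrite e0.
- have -> : l * w * s = w * z by rewrite /z; ring.
  apply: le_trans wx; apply: ler_wpM2l; first exact: ltW.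
  rewrite xz; nra.
- have -> : tau * l ^+ 2 * w ^+ 2 = x * w ^+ 2 by rewrite /x; ring.
  have : x * w ^+ 2 <= x * w by rewrite ler_wpM2l // expr2 ler_piMl // ltW.
  have : 0 <= x * w by rewrite mulr_ge0 // ltW.
  lra.
- have -> : 2 * l * s = 2 * z by rewrite /z; ring.
  have h1 : (1 - w) ^+ 2 <= 1 - w by nra.
  apply: le_trans h1 _; have [z1|z1] := leP z 1; last lra.
  rewrite xz in wl; nra.
- move=> l4.
  have : tau / 16 <= x.
    have : (1 / 4) ^+ 2 <= l ^+ 2 by rewrite lerXn2r ?nnegrE //; lra.
    move=> /(ler_wpM2r (ltW t0)); rewrite -/x; lra.
  move=> xt.
  have : w * (1 + tau / 8) <= 1.
    by apply: le_trans wx; apply: ler_wpM2l; [exact: ltW|lra].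
  nra.
Qed.

End ExpBounds.

Ltac nonneg := repeat first
  [ exact: sqr_ge0 | done | apply: exprn_ge0 | (apply: ltW; done) | apply: mulr_ge0
  | rewrite invr_ge0 | apply: addr_ge0 ].

(** * Deterministic estimates for one step: drift, energy and flux *)

Section EnergyEstimate.
Variables (R : realType) (a0 a1 a2 a3 : R).
Hypothesis a0_gt0 : 0 < a0.

Local Notation F := (fcub a0 a1 a2 a3).
Local Notation slope_ub := (slope_ub a0 a1 a2).
Local Notation drift_cst := (drift_cst a0 a1 a2).
Local Notation growth_cst := (growth_cst a0 a1 a2 a3).
Local Notation slope := (slope a0 a1 a2).

Lemma synD N (a b : nat -> R) i : syn N (fun j => a j + b j) i = syn N a i + syn N b i.
Proof. by rewrite /syn -big_split; apply: eq_bigr => j _; rewrite mulrDl. Qed.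

Lemma dform_fcub N (U : vec R) M : (2 <= N)%N -> (forall i, U i ^+ 2 <= M) ->
  dform N (F \o U) (F \o U) <= slope_ub ^+ 2 * (1 + 2 * M) ^+ 2 * dform N U U.
Proof.
move=> N2 UM; rewrite /dform mulrCA; apply: ler_wpM2l.
  by rewrite invr_ge0 ltW // hN_gt0.
rewrite mulr_sumr; apply: ler_sum => l _ /=.
rewrite -!expr2 (fcubB a0 a1 a2 a3) exprMn; apply: ler_wpM2r; first exact: sqr_ge0.
exact: slope_sqr.
Qed.

Lemma l2ip_fcubB N (U V : vec R) M : (2 <= N)%N ->
  (forall i, U i ^+ 2 <= M) -> (forall i, V i ^+ 2 <= M) ->
  l2ip N (fun i => F (U i) - F (V i)) (fun i => F (U i) - F (V i)) <=
  slope_ub ^+ 2 * (1 + 2 * M) ^+ 2 * l2ip N (fun i => U i - V i) (fun i => U i - V i).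
Proof.
move=> N2 UM VM; rewrite /l2ip mulrCA; apply: ler_wpM2l.
  by rewrite ltW // hN_gt0.
rewrite mulr_sumr; apply: ler_sum => l _ /=.
rewrite -!expr2 (fcubB a0 a1 a2 a3) exprMn; apply: ler_wpM2r; first exact: sqr_ge0.
exact: slope_sqr.
Qed.

(** [slope_drift] summed over the cells. Passing from the squares of [Yt + O] to those of [Yt] uses
    [ya^2 <= 2 a^2 + 18 B]; it halves [a0 / 8] and creates the term [9 * a0 / 4 * B]. *)
Lemma drift_grid N (yt o : nat -> R) (B m : R) : (2 <= N)%N ->
  (forall i, (i < N)%N -> syn N yt i ^+ 2 <= m) -> (forall i, syn N o i ^+ 2 <= 9 * B) ->
  - dform N (syn N yt) (F \o syn N (fun j => yt j + o j)) <=
  - (a0 / 16) * quart N (syn N yt) + (drift_cst + 9 * a0 / 4 * B) * gradsq N yt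
  + drift_cst * (1 + 4 * m + 36 * B) * gradsq N o.
Proof.
move=> N2; set Y := syn N yt; set O := syn N o => Ym OB.
have h0 := hN_gt0 R N2.
rewrite -!dform_synE // -/Y -/O /dform /quart.
rewrite !(mulrCA _ (hN R N)^-1) -mulrN -!mulrDr; apply: ler_wpM2l; first by rewrite invr_ge0 ltW.
rewrite -sumrN !mulr_sumr -!big_split; apply: ler_sum => l _ /=.
have lN : (l < N)%N by apply: leq_trans (ltn_ord l) (leq_pred N).
have lN' : (l.+1 < N)%N by rewrite -ltn_predRL ltn_ord.
rewrite !synD -/Y -/O (fcubB a0 a1 a2 a3).
have := Ym _ lN; have := Ym _ lN'; have := OB l; have := OB l.+1.
move: (Y l) (Y l.+1) (O l) (O l.+1) => ya yb oa ob.
set p := yb - ya; set r := ob - oa; set a := ya + oa; set b := yb + ob.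
move=> hob hoa hyb hya.
have -> : b - a = p + r by rewrite /p /r /a /b; ring.
have -> : p * (slope a b * (p + r)) = slope a b * p * (p + r) by ring.
apply: le_trans (slope_drift a1 a2 a0_gt0 a b p r) _.
have c0 := drift_cst_ge0 a1 a2 a0_gt0.
have p2 := sqr_ge0 p; have r2 := sqr_ge0 r.
have ha : a ^+ 2 <= 2 * m + 18 * B.
  have := sqr_ge0 (ya - oa); rewrite /a sqrrB sqrrD; lra.
have hb : b ^+ 2 <= 2 * m + 18 * B.
  have := sqr_ge0 (yb - ob); rewrite /b sqrrB sqrrD; lra.
have ka : ya ^+ 2 <= 2 * a ^+ 2 + 18 * B.
  have := sqr_ge0 (ya + 2 * oa); rewrite /a sqrrD exprMn sqrrD; lra.
have kb : yb ^+ 2 <= 2 * b ^+ 2 + 18 * B.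
  have := sqr_ge0 (yb + 2 * ob); rewrite /b sqrrD exprMn sqrrD; lra.
rewrite -!expr2; apply: lerD; last first.
  rewrite -mulrA; apply: (@le_trans _ _ (drift_cst * ((1 + 4 * m + 36 * B) * r ^+ 2))); last by rewrite mulrA.
  apply: ler_wpM2l => //; apply: ler_wpM2r => //; lra.
have := ler_wpM2r p2 (ler_wpM2l (ltW a0_gt0) (lerD ka kb)).
have := a0_gt0; rewrite !mulrDl !mulrDr !mulrDl; nra.
Qed.

(** The variable [m = varsq (syn yt)] stands in for the squared maximum of [Yt]. Apart from
    [|A Yt|^2 / 8], every positive term is at most linear in [m] with a coefficient depending on
    [B], so the negative [m^2] absorbs it. *)
Lemma drift_bound : exists2 C : R, 0 <= C & forall N (yt o : nat -> R), (2 <= N)%N -> yt 0%N = 0 ->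
  - dform N (syn N yt) (F \o syn N (fun j => yt j + o j)) <=
    8^-1 * \sum_(j < N) lamN R N j ^+ 2 * yt j ^+ 2 + C * (1 + w12sq N o) ^+ 4.
Proof.
have c0 := drift_cst_ge0 a1 a2 a0_gt0.
have pp := pi_gt0 R.
(* By [varsq_quart], [a0 / 16 * quart] is at least [c * m^2] for this [c]. *)
pose c := a0 / (32 * pi).
have cp : 0 < c by rewrite divr_gt0 // mulr_gt0.
pose K := 2 * pi * (drift_cst + 9 * a0 / 4) ^+ 2 + 4 * drift_cst.
have K0 : 0 <= K.
  by rewrite /K; nonneg.
exists (K ^+ 2 / (4 * c) + 36 * drift_cst).
  by nonneg.
move=> N yt o N2 y0.
set B := w12sq N o; pose m := varsq N (syn N yt).
have Ym i : (i < N)%N -> syn N yt i ^+ 2 <= m.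
  by apply: sup_varsq => //; exact: sum_syn_eq0.
apply: le_trans (drift_grid N2 Ym (sup_w12 N2 o)) _; rewrite -/B.
have B0 : 0 <= B := w12sq_ge0 N o.
have m0 : 0 <= m := varsq_ge0 N _.
have go : gradsq N o <= B by rewrite /B w12sqE lerDr l2sq_ge0.
have go0 := gradsq_ge0 N o.
have qm : - (a0 / 16) * quart N (syn N yt) <= - c * m ^+ 2.
  have q1 := varsq_quart N2 (syn N yt); rewrite -/m in q1.
  rewrite !mulNr lerN2.
  have -> : a0 / 16 * quart N (syn N yt) = c * (2 * pi * quart N (syn N yt)).
    by rewrite /c; move: (pi : R) pp => P pp; field; rewrite gt_eqF.
  by apply: ler_wpM2l q1; exact: ltW.
set k := drift_cst + 9 * a0 / 4 * B.
have k0 : 0 <= k by rewrite /k; nonneg.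
have kB : k <= (drift_cst + 9 * a0 / 4) * (1 + B).
  have := mulr_ge0 c0 B0; have := a0_gt0; rewrite /k; lra.
have l2m : l2sq N yt <= pi * m.
  have -> : pi * m = hN R N * (N%:R * m) by rewrite mulrA [hN R N * _]mulrC hNN.
  rewrite -l2ip_synE // /l2ip.
  apply: ler_wpM2l; first by rewrite ltW // hN_gt0.
  apply: (@le_trans _ _ (\sum_(i < N) m)); last by rewrite sumr_const card_ord mulr_natl.
  by apply: ler_sum => i _; rewrite -expr2; apply: sup_varsq => //; exact: sum_syn_eq0.
set L := \sum_(j < N) _.
(* Interpolation on each mode, [k * lam <= lam^2 / 8 + 2 * k^2], followed by [|Yt|^2 <= pi * m]. *)
have kg : k * gradsq N yt <= 8^-1 * L + 2 * k ^+ 2 * (pi * m).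
  apply: (@le_trans _ _ (8^-1 * L + 2 * k ^+ 2 * l2sq N yt)); last first.
    by rewrite lerD2l; apply: ler_wpM2l l2m; rewrite mulr_ge0 ?sqr_ge0.
  rewrite /L /l2sq /gradsq !mulr_sumr -big_split; apply: ler_sum => j _ /=.
  rewrite -subr_ge0 (_ : _ - _ = 8^-1 * (lamN R N j - 4 * k) ^+ 2 * yt j ^+ 2); last by field.
  by rewrite mulr_ge0 ?sqr_ge0 // mulr_ge0 ?sqr_ge0.
(* The total coefficient of [m]: one part from the interpolated gradient, one from the last term of
   [drift_grid]. *)
pose A := 2 * k ^+ 2 * pi + 4 * drift_cst * B.
have A0 : 0 <= A by rewrite /A; nonneg.
have AK : A <= K * (1 + B) ^+ 2.
  have -> : K * (1 + B) ^+ 2 = 2 * pi * (drift_cst + 9 * a0 / 4) ^+ 2 * (1 + B) ^+ 2 + 4 * drift_cst * (1 + B) ^+ 2.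
    by rewrite -[in RHS]mulrDl.
  apply: lerD.
    have : k ^+ 2 <= ((drift_cst + 9 * a0 / 4) * (1 + B)) ^+ 2.
      rewrite lerXn2r ?nnegrE // mulr_ge0 //; last lra.
      have := a0_gt0; lra.
    rewrite exprMn => /(ler_wpM2l (ltW pp)); lra.
  apply: ler_wpM2l; first by rewrite mulr_ge0.
  nra.
have Am : A * m <= c * m ^+ 2 + A ^+ 2 / (4 * c).
  rewrite -subr_ge0 (_ : _ - _ = c * (m - A / (2 * c)) ^+ 2); last by field; rewrite gt_eqF.
  by rewrite mulr_ge0 ?sqr_ge0 // ltW.
have A2 : A ^+ 2 / (4 * c) <= K ^+ 2 / (4 * c) * (1 + B) ^+ 4.
  have -> : K ^+ 2 / (4 * c) * (1 + B) ^+ 4 = (K * (1 + B) ^+ 2) ^+ 2 / (4 * c).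
    by field; rewrite gt_eqF.
  by apply: ler_wpM2r; [nonneg|rewrite lerXn2r ?nnegrE //; nonneg; lra].
have last : drift_cst * (1 + 4 * m + 36 * B) * gradsq N o <= drift_cst * (1 + 4 * m + 36 * B) * B.
  by apply: ler_wpM2l go; rewrite mulr_ge0 //; lra.
have B4 : (1 + 36 * B) * B <= 36 * (1 + B) ^+ 4.
  have : (1 + B) ^+ 2 <= (1 + B) ^+ 4 by apply: ler_weXn2l => //; lra.
  nra.
have := ler_wpM2l c0 B4.
move: Am A2; rewrite /A => Am A2; lra.
Qed.

(** The taming factor enters only as a number [theta] in [[0, 1]] with [theta * s * E^3 <= 1], where
    [s] is the root of [tau] and [E] a squared [w12] norm. The conclusion is shaped as a convex
    combination with weight [tau / 18], ready for iteration. *)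
Lemma energy_step : exists2 C : R, 0 <= C & forall N (tau s theta : R) (y o : nat -> R),
  (2 <= N)%N -> 0 < tau < 1 -> 0 <= s -> s ^+ 2 = tau -> 0 <= theta <= 1 ->
  theta * (s * w12sq N (fun j => y j + o j) ^+ 3) <= 1 -> y 0%N = 0 ->
  l2sq N (fun j => expR (- lamN R N j ^+ 2 * tau) *
     (y j - tau * lamN R N j * (theta * coef N (F \o syn N (fun j => y j + o j)) j)))
  <= (1 - tau / 18) * l2sq N y + tau / 18 * (C * (1 + w12sq N o) ^+ 4).
Proof.
have [C1 C10 drift] := drift_bound.
pose K1 := slope_ub ^+ 2 * (108 ^+ 2 * 144).
pose K2 := slope_ub ^+ 2 * (18 ^+ 2 * 18).
have K10 : 0 <= K1 by rewrite /K1; nonneg.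
have K20 : 0 <= K2 by rewrite /K2; nonneg.
(* Contributions per unit of [tau]: [2 * C1] from the drift, [2 * K1] from replacing [F(U)] by
   [F(V)], [K2] from the quadratic term. The [18] compensates the weight [tau / 18]. *)
exists (18 * (2 * C1 + 2 * K1 + K2)); first by lra.
move=> N tau s th y o N2 t01 s0 st /andP[th0 th1] thE y0.
have /andP[t0 t1] := t01.
have s1 : s <= 1 by rewrite -(@ler_pXn2r _ 2) ?nnegrE // st expr1n ltW.
pose e j := expR (- lamN R N j ^+ 2 * tau).
have step j := expR_step (lamN_ge0 R N j) t01 s0 st.
set U := syn N _.
set E := w12sq N _ in thE *.
pose B := w12sq N o.
pose yt j := e j ^+ 2 * y j.
pose V := syn N (fun j => yt j + o j).
pose f j := coef N (F \o U) j.
pose g j := coef N (F \o V) j.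
have E0 : 0 <= E := w12sq_ge0 N _.
have B0 : 0 <= B := w12sq_ge0 N _.
pose D := \sum_(j < N) (1 - e j ^+ 2) * y j ^+ 2.
pose L := \sum_(j < N) lamN R N j ^+ 2 * yt j ^+ 2.
have LD : tau * L <= D.
  rewrite /L mulr_sumr; apply: ler_sum => j _; set l := lamN R N j.
  have -> : tau * (l ^+ 2 * yt j ^+ 2) = tau * l ^+ 2 * e j ^+ 4 * y j ^+ 2 by rewrite /yt; ring.
  by apply: ler_wpM2r; [exact: sqr_ge0|case: (step j)].
have Dy : tau / 9 * l2sq N y <= D.
  rewrite /l2sq mulr_sumr; apply: ler_sum => -[[|j] jN] _ /=; first by rewrite y0 expr0n !mulr0.
  apply: ler_wpM2r; first exact: sqr_ge0.
  by case: (step j.+1) => _ _ _ _; apply; exact: lamN_gap.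
have wy : w12sq N y <= 2 * E + 2 * B.
  apply: w12sq_half => j _; have := sqr_ge0 (y j + 2 * o j); rewrite sqrrD exprMn sqrrD; lra.
have wyt : w12sq N yt <= w12sq N y.
  apply: ler_sum => j _; apply: ler_wpM2l; first by have := lamN_ge0 R N j; lra.
  rewrite /yt exprMn ler_piMl ?sqr_ge0 // -exprM expr_le1 //; case: (step j) => /andP[e0 e1] _ _ _ _ //.
  exact: ltW.
have wV : w12sq N (fun j => yt j + o j) <= 4 * E + 6 * B.
  have : w12sq N (fun j => yt j + o j) <= 2 * w12sq N yt + 2 * B.
    apply: w12sq_half => j _; have := sqr_ge0 (yt j - o j); rewrite sqrrB sqrrD; lra.
  lra.
pose M := 9 * (4 * E + 6 * B).
have UM i : U i ^+ 2 <= M.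
  by apply: le_trans (sup_w12 N2 _ i) _; rewrite -/E /M; lra.
have VM i : V i ^+ 2 <= M.
  by apply: le_trans (sup_w12 N2 _ i) _; rewrite /M; lra.
(* Replacing [Y] by [Yt] inside the nonlinearity: two powers of [M] from the Lipschitz constant, and
   [s] times a squared [w12] norm from [(1 - e^2)^2 <= 2 * l * s]. *)
have fg : \sum_(j < N) (f j - g j) ^+ 2 <= slope_ub ^+ 2 * (1 + 2 * M) ^+ 2 * (2 * s * (2 * E + 2 * B)).
  have -> : \sum_(j < N) (f j - g j) ^+ 2 = l2ip N (fun i => F (U i) - F (V i)) (fun i => F (U i) - F (V i)).
    rewrite (parseval N2); apply: eq_bigr => j _; rewrite expr2.
    suff -> : f j - g j = coef N (fun i => F (U i) - F (V i)) j by [].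
    rewrite /f /g /coef /l2ip -mulrBr -sumrB; congr (_ * _); apply: eq_bigr => i _ /=.
    by rewrite mulrBl.
  apply: le_trans (l2ip_fcubB N2 UM VM) _; apply: ler_wpM2l; first by rewrite mulr_ge0 ?sqr_ge0.
  have -> : l2ip N (fun i => U i - V i) (fun i => U i - V i) = l2sq N (fun j => y j - yt j).
    rewrite -l2ip_synE //.
    have UV i : U i - V i = syn N (fun j => y j - yt j) i.
      rewrite /U /V /syn -sumrB; apply: eq_bigr => j _; ring.
    by apply: eq_l2ip.
  apply: (@le_trans _ _ (2 * s * w12sq N y)); last first.
    by apply: ler_wpM2l wy; rewrite mulr_ge0.
  rewrite /l2sq /w12sq mulr_sumr; apply: ler_sum => j _.
  have -> : y j - yt j = (1 - e j ^+ 2) * y j by rewrite /yt; ring.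
  rewrite exprMn mulrA; apply: ler_wpM2r; first exact: sqr_ge0.
  by case: (step j) => _ _ _ h _; apply: le_trans h _; lra.
(* The hypothesis on [theta] is spent here: both error terms below have size [s * (1 + E + B)^3],
   and [E] disappears from the bound. *)
have ths : th ^+ 2 * (s * (1 + E + B) ^+ 3) <= 18 * (1 + B) ^+ 4.
  have p3 : (1 + E + B) ^+ 3 <= 9 * (1 + E ^+ 3 + B ^+ 3).
    have h1 : 0 <= (E - B) ^+ 2 * (E + B) by rewrite mulr_ge0 ?sqr_ge0 // addr_ge0.
    have h2 : 0 <= (E - 1) ^+ 2 * (E + 1) by rewrite mulr_ge0 ?sqr_ge0 // addr_ge0.
    have h3 : 0 <= (B - 1) ^+ 2 * (B + 1) by rewrite mulr_ge0 ?sqr_ge0 // addr_ge0.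
    have h4 : 0 <= (1 + E + B) * ((E - B) ^+ 2 + (E - 1) ^+ 2 + (B - 1) ^+ 2).
      by rewrite mulr_ge0 ?addr_ge0 ?sqr_ge0.
    nra.
  have tE : th ^+ 2 * (s * E ^+ 3) <= 1.
    rewrite expr2 -mulrA; apply: le_trans thE; rewrite ler_piMl //.
    by rewrite mulr_ge0 // mulr_ge0 ?exprn_ge0.
  have t2 : th ^+ 2 * s <= 1 by rewrite mulr_ile1 ?sqr_ge0 // expr_le1.
  have t20 : 0 <= th ^+ 2 * s by rewrite mulr_ge0 ?sqr_ge0.
  have B30 : 0 <= B ^+ 3 by rewrite exprn_ge0.
  have t3 : th ^+ 2 * s * B ^+ 3 <= B ^+ 3 by rewrite ler_piMl.
  have b4 : 1 + B ^+ 3 <= (1 + B) ^+ 4.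
    have : 0 <= B ^+ 2 by rewrite sqr_ge0.
    have : 0 <= B ^+ 4 by rewrite exprn_ge0.
    have -> : (1 + B) ^+ 4 = 1 + 4 * B + 6 * B ^+ 2 + 4 * B ^+ 3 + B ^+ 4 by ring.
    lra.
  have := ler_wpM2l t20 p3; rewrite mulrA; lra.
have T2 : th ^+ 2 * \sum_(j < N) (f j - g j) ^+ 2 <= K1 / 2 * (1 + B) ^+ 4.
  apply: le_trans (ler_wpM2l (sqr_ge0 th) fg) _.
  have m1 : (1 + 2 * M) ^+ 2 <= (108 * (1 + E + B)) ^+ 2.
    rewrite lerXn2r ?nnegrE /M; lra.
  have m2 : (1 + 2 * M) ^+ 2 * (2 * s * (2 * E + 2 * B)) <= 108 ^+ 2 * 4 * (s * (1 + E + B) ^+ 3).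
    apply: (@le_trans _ _ ((108 * (1 + E + B)) ^+ 2 * (4 * s * (1 + E + B)))); last by rewrite exprMn; lra.
    apply: ler_pM => //; first exact: sqr_ge0.
      by rewrite mulr_ge0 // ?mulr_ge0 //; lra.
    have := mulr_ge0 s0 E0; have := mulr_ge0 s0 B0; nra.
  have := ler_wpM2l (sqr_ge0 (th * slope_ub)) m2.
  have := ler_wpM2l (sqr_ge0 slope_ub) ths.
  rewrite exprMn /K1; lra.
have T3 : th ^+ 2 * s * \sum_(j < N) lamN R N j * f j ^+ 2 <= K2 * (1 + B) ^+ 4.
  have -> : \sum_(j < N) lamN R N j * f j ^+ 2 = dform N (F \o U) (F \o U).
    by rewrite (dform_coef N2); apply: eq_bigr => j _; rewrite expr2 mulrA.
  have U9 i : U i ^+ 2 <= 9 * E by exact: sup_w12.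
  have d1 := dform_fcub N2 U9.
  have d2 : dform N U U <= E by rewrite dform_synE // /E w12sqE lerDr l2sq_ge0.
  have d3 : (1 + 2 * (9 * E)) ^+ 2 * dform N U U <= 18 ^+ 2 * (1 + E + B) ^+ 3.
    apply: (@le_trans _ _ ((18 * (1 + E + B)) ^+ 2 * (1 + E + B))); last by rewrite exprMn; lra.
    apply: ler_pM; rewrite ?sqr_ge0 //; last lra.
      by rewrite dform_synE // gradsq_ge0.
    by rewrite lerXn2r ?nnegrE; lra.
  have t20 : 0 <= th ^+ 2 * s by rewrite mulr_ge0 ?sqr_ge0.
  have := ler_wpM2l t20 d1.
  have := ler_wpM2l (mulr_ge0 (sqr_ge0 slope_ub) t20) d3.
  have := ler_wpM2l (sqr_ge0 slope_ub) ths.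
  rewrite /K2; lra.
have T1 : th * (- \sum_(j < N) lamN R N j * yt j * g j) <= 8^-1 * L + C1 * (1 + B) ^+ 4.
  have := drift N yt o N2; rewrite {1}/yt y0 mulr0 => /(_ erefl).
  rewrite (dform_coef N2) -/V -/L -/B.
  under eq_bigr do rewrite coef_syn //.
  move=> d; have r0 : 0 <= 8^-1 * L + C1 * (1 + B) ^+ 4.
    have B10 : 0 <= 1 + B by rewrite addr_ge0.
    have L0 : 0 <= L by apply: sumr_ge0 => j _; rewrite mulr_ge0 ?sqr_ge0.
    by rewrite addr_ge0 // mulr_ge0 // exprn_ge0.
  by apply: le_trans (ler_wpM2l th0 d) _; rewrite ler_piMl.
have T4 : th * (- \sum_(j < N) lamN R N j * yt j * (f j - g j)) <= 8^-1 * L + 2 * (th ^+ 2 * \sum_(j < N) (f j - g j) ^+ 2).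
  rewrite /L -sumrN !mulr_sumr -big_split; apply: ler_sum => j _ /=.
  rewrite -subr_ge0 (_ : _ - _ = 8^-1 * (lamN R N j * yt j + 4 * th * (f j - g j)) ^+ 2); last by field.
  by rewrite mulr_ge0 ?sqr_ge0.
(* Smoothing [l * e^2 * s <= 1] removes one factor [l] for half a power of [tau]; the remaining [l]
   forms the Dirichlet form of [F(U)]. *)
have T5 : \sum_(j < N) tau ^+ 2 * th ^+ 2 * (e j ^+ 2 * lamN R N j ^+ 2 * f j ^+ 2) <= tau * (th ^+ 2 * s * \sum_(j < N) lamN R N j * f j ^+ 2).
  rewrite !mulr_sumr; apply: ler_sum => j _; case: (step j) => _ h _ _ _.
  have l0 := lamN_ge0 R N j.
  have -> : tau ^+ 2 * th ^+ 2 * (e j ^+ 2 * lamN R N j ^+ 2 * f j ^+ 2) =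
    tau * th ^+ 2 * s * (lamN R N j * f j ^+ 2) * (lamN R N j * e j ^+ 2 * s) by rewrite -st; ring.
  have -> : tau * (th ^+ 2 * s * (lamN R N j * f j ^+ 2)) = tau * th ^+ 2 * s * (lamN R N j * f j ^+ 2) by ring.
  by rewrite ler_piMr //; nonneg.
have -> : l2sq N (fun j => expR (- lamN R N j ^+ 2 * tau) * (y j - tau * lamN R N j * (th * coef N (F \o U) j))) =
  l2sq N y - D + 2 * tau * (th * (- \sum_(j < N) lamN R N j * yt j * g j) + th * (- \sum_(j < N) lamN R N j * yt j * (f j - g j)))
  + \sum_(j < N) tau ^+ 2 * th ^+ 2 * (e j ^+ 2 * lamN R N j ^+ 2 * f j ^+ 2).
  have H (c : R) (a : 'I_N -> R) : c * (- \sum_(j < N) a j) = \sum_(j < N) c * (- a j).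
    by rewrite -sumrN mulr_sumr.
  rewrite /D /l2sq !H -big_split mulr_sumr -sumrB -!big_split.
  by apply: eq_bigr => j _ /=; rewrite -/(e j) -/(f j) /yt; ring.
(* [T1] and [T4] together cost [2 * tau * (1/8 + 1/8) * L <= D / 2]; the other half of [D] is at
   least [tau / 18 * l2sq N y]. *)
have tp := ltW t0.
have m1 := ler_wpM2l tp T1; have m2 := ler_wpM2l tp T2; have m3 := ler_wpM2l tp T3; have m4 := ler_wpM2l tp T4.
rewrite -/B; nra.
Qed.

(** As basis functions are bounded by [1], the coefficient is an [L^1] quantity. Cauchy-Schwarz with
    weight [1 + U^2] leaves a single factor [1 + |U|_oo^2], which is linear in the squared gradient
    with a coefficient that [varsq_young] can make small. *)
Lemma flux_bound (eps : R) : 0 < eps -> exists2 C : R, 0 <= C & forall N (y o : nat -> R) j,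
  (2 <= N)%N -> y 0%N = 0 ->
  coef N (F \o syn N (fun j => y j + o j)) j ^+ 2 <=
  eps * gradsq N y + C * (1 + l2sq N y + w12sq N o) ^+ 5.
Proof.
move=> eps0; have c0 := growth_cst_gt0 a1 a2 a3 a0_gt0.
pose k := 36 * growth_cst; have k0 : 0 < k by rewrite mulr_gt0.
exists (4 * k ^+ 2 / eps + 18 * k).
  by nonneg.
move=> N y o j N2 y0; have h0 := hN_gt0 R N2.
set U := syn N _; set n := l2sq N y; set B := w12sq N o; set X := gradsq N y.
have n0 : 0 <= n := l2sq_ge0 N y.
have B0 : 0 <= B := w12sq_ge0 N o.
have X0 : 0 <= X := gradsq_ge0 N y.
pose Z := 1 + n + B; have Z1 : 1 <= Z by rewrite /Z; lra.
(* Chosen so that the prefactor [growth_cst * (6 * Z)^2 = k * Z^2] times [s^-1] is exactly [eps]. *)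
pose s := k * Z ^+ 2 / eps.
have s0 : 0 < s by rewrite divr_gt0 // mulr_gt0 // exprn_gt0; lra.
pose M := 4 * s * n + s^-1 * X + 18 * B.
have UM i : (i < N)%N -> U i ^+ 2 <= M.
  move=> iN; have -> : U i = syn N y i + syn N o i by rewrite /U synD.
  have h1 := sup_varsq N2 (sum_syn_eq0 N2 y0) iN.
  have h2 := sup_w12 N2 o i.
  have h3 := varsq_young N2 (syn N y) s0; rewrite l2ip_synE // dform_synE // -/n -/X in h3.
  have h4 := sqr_ge0 (syn N y i - syn N o i); rewrite sqrrB in h4.
  have -> : M = 2 * (2 * s * n + (2 * s)^-1 * X) + 18 * B by rewrite /M; field; rewrite gt_eqF.
  rewrite sqrrD; rewrite -/B in h2; lra.
have W : hN R N * \sum_(i < N) (1 + U i ^+ 2) <= 6 * Z.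
  rewrite big_split /= sumr_const card_ord mulrDr -/(l2ip N U U) -[1 *+ N]/(N%:R) mulrC hNN //.
  rewrite l2ip_synE //.
  have : l2sq N (fun j => y j + o j) <= 2 * n + 2 * l2sq N o.
    rewrite /n /l2sq !mulr_sumr -big_split; apply: ler_sum => i _ /=.
    have := sqr_ge0 (y i - o i); rewrite sqrrB sqrrD; lra.
  have : l2sq N o <= B by rewrite /B w12sqE lerDl gradsq_ge0.
  have := pihalf_lt2 R; rewrite /Z; lra.
have cf : coef N (F \o U) j ^+ 2 <= growth_cst * (6 * Z) ^+ 2 * (1 + M).
  have U1 i : 0 < 1 + U i ^+ 2 by have := sqr_ge0 (U i); lra.
  have -> : coef N (F \o U) j = \sum_(i < N) hN R N * (1 + U i ^+ 2) * (F (U i) * phiN R N j i / (1 + U i ^+ 2)).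
    rewrite /coef /l2ip mulr_sumr; apply: eq_bigr => i _ /=.
    by field; rewrite gt_eqF.
  apply: le_trans (jensen_sqr _ _) _; first by move=> i; rewrite mulr_ge0 // ltW.
  rewrite -mulr_sumr; set S := hN R N * _ in W *.
  have S0 : 0 <= S by rewrite mulr_ge0 ?sumr_ge0 // => [|i _]; rewrite ltW.
  apply: (@le_trans _ _ (S * (growth_cst * (1 + M) * S))); last first.
    have M0 : 0 <= M.
      have N0 : (0 < N)%N by exact: ltnW.
      by apply: le_trans (UM 0%N N0); exact: sqr_ge0.
    have -> : S * (growth_cst * (1 + M) * S) = growth_cst * S ^+ 2 * (1 + M) by ring.
    apply: ler_wpM2r; first lra.
    by rewrite ler_pM2l // lerXn2r ?nnegrE //; lra.
  apply: ler_wpM2l => //; rewrite /S mulrCA !mulr_sumr; apply: ler_sum => i _.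
  rewrite -mulrA; apply: ler_wpM2l; first exact: ltW.
  rewrite mulrC; apply: ler_wpM2r; first exact: ltW.
  rewrite expr_div_n ler_pdivrMr ?exprn_gt0 //.
  apply: (@le_trans _ _ (F (U i) ^+ 2)).
    rewrite exprMn ler_piMr ?sqr_ge0 // -real_normK ?num_real // expr_le1 //; exact: norm_phi_le1.
  apply: le_trans (fcub_sqr a0 a1 a2 a3 _) _; rewrite -[leRHS]mulrA ler_pM2l // exprS.
  by apply: ler_wpM2r; [exact: sqr_ge0|rewrite lerD2l; apply: UM].
apply: le_trans cf _.
have -> : growth_cst * (6 * Z) ^+ 2 * (1 + M) = eps * X + 4 * k ^+ 2 / eps * (Z ^+ 4 * n) + k * (Z ^+ 2 * (1 + 18 * B)).
  rewrite /M /s /k; field; rewrite !gt_eqF //; lra.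
rewrite -addrA lerD2l [leRHS]mulrDl; apply: lerD.
  apply: ler_wpM2l; first by nonneg.
  rewrite -/Z [leRHS]exprSr; apply: ler_wpM2l; first by rewrite exprn_ge0 //; lra.
  by rewrite /Z; lra.
rewrite [18 * k]mulrC -[leRHS]mulrA; apply: ler_wpM2l; first exact: ltW.
apply: (@le_trans _ _ (Z ^+ 2 * (18 * Z))).
  by apply: ler_wpM2l; [exact: sqr_ge0|rewrite /Z; lra].
have -> : Z ^+ 2 * (18 * Z) = 18 * Z ^+ 3 by ring.
by rewrite ler_pM2l // ler_weXn2l.
Qed.

End EnergyEstimate.

(** * Integrals of functions of a random variable *)

Section IntegralTools.
Context (d : measure_display) (T : measurableType d) (R : realType).
Local Open Scope ereal_scope.
Import HBNNSimple.

(** The integral of a nonnegative function is a supremum over the simple functions below it, hence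
    monotone. The statement makes no measurability assumption because it is applied to powers of
    [Linf_norm], itself a supremum over uncountably many points. *)
Lemma le_integral_pointwise (mu : {measure set T -> \bar R}) (f g : T -> \bar R) :
  (forall x, 0 <= f x) -> (forall x, f x <= g x) -> \int[mu]_x f x <= \int[mu]_x g x.
Proof.
move=> f0 fg; rewrite !ge0_integralTE//; last by move=> x; exact: le_trans (fg x).
by apply: le_ereal_sup => _ [h /= hf <-]; exists h => //= x; exact: le_trans (hf x) (fg x).
Qed.

Section Density.
Context (d' : measure_display) (Y : measurableType d').
Variables (mu : {measure set T -> \bar R}) (X : T -> R) (xi : T -> Y).
Hypotheses (mX : measurable_fun setT X) (X0 : forall t, (0 <= X t)%R).
Hypothesis mxi : measurable_fun setT xi.

Lemma integral_comp_nnsfun (h : {nnsfun Y >-> R}) :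
  \int[mu]_t (X t * h (xi t))%:E =
  \sum_(r \in range h) r%:E * \int[mu]_t (X t * \1_(h @^-1` [set r]) (xi t))%:E.
Proof.
under eq_integral.
  move=> t _; rewrite EFinM fimfunE -fsumEFin// ge0_mule_fsumr; last first.
    by move=> r; rewrite EFinM nnfun_muleindic_ge0.
  over.
rewrite ge0_integral_fsum//; last 2 first.
- move=> r; apply/measurable_EFinP; apply: measurable_funM => //.
  by apply: measurable_funM => //; apply: measurableT_comp => //; exact: measurable_indic.
- by move=> r t _; apply: mule_ge0; [rewrite lee_fin|rewrite EFinM nnfun_muleindic_ge0].
apply: eq_fsbigr => r; rewrite inE => -[x _ <-].
rewrite -ge0_integralZl//.
- by apply: eq_integral => t _; rewrite -!EFinM mulrCA.
- apply/measurable_EFinP; apply: measurable_funM => //.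
  by apply: measurableT_comp => //; exact: measurable_indic.
- by move=> t _; rewrite lee_fin mulr_ge0.
- by rewrite lee_fin.
Qed.

Lemma integral_comp_lim (g : Y -> R) (mg : measurable_fun setT (EFin \o g)) : (forall x, 0 <= g x)%R ->
  \int[mu]_t (X t * g (xi t))%:E =
  limn (fun n => \int[mu]_t (X t * nnsfun_approx measurableT mg n (xi t))%:E).
Proof.
move=> g0; have G0 x : setT x -> 0 <= (EFin \o g) x by rewrite /= lee_fin.
rewrite -monotone_convergence//=.
- apply: eq_integral => t _; apply/esym/cvg_lim => //=.
  rewrite EFinM; under eq_fun do rewrite EFinM.
  by apply: cvgeMl => //; exact: (cvg_nnsfun_approx measurableT mg G0).
- move=> n; apply/measurable_EFinP; apply: measurable_funM => //.
  by apply: measurableT_comp.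
- by move=> n x _; rewrite lee_fin mulr_ge0.
- by move=> x _ a b ab; rewrite lee_fin ler_wpM2l//; exact/lefP/nd_nnsfun_approx.
Qed.

End Density.

End IntegralTools.

Section SameLaw.
Import HBNNSimple.
Context (R : realType) (d1 d2 d' : measure_display).
Context (T1 : measurableType d1) (T2 : measurableType d2) (Y : measurableType d').
Variables (mu1 : {measure set T1 -> \bar R}) (X1 : T1 -> R) (xi1 : T1 -> Y).
Variables (mu2 : {measure set T2 -> \bar R}) (X2 : T2 -> R) (xi2 : T2 -> Y).
Hypotheses (mX1 : measurable_fun setT X1) (X10 : forall t, (0 <= X1 t)%R).
Hypotheses (mX2 : measurable_fun setT X2) (X20 : forall t, (0 <= X2 t)%R).
Hypotheses (mxi1 : measurable_fun setT xi1) (mxi2 : measurable_fun setT xi2).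

(** Equality on indicators extends to simple functions and, by monotone convergence, to nonnegative
    measurable ones. Two spaces and two weights serve both applications: replacing one factor of an
    independent product by its mean, and passing from a law on [T] to a density on the line. *)
Lemma eq_weighted_law (g : Y -> R) :
  (forall B : set Y, measurable B -> \int[mu1]_t (X1 t * \1_B (xi1 t))%:E =
                                   \int[mu2]_t (X2 t * \1_B (xi2 t))%:E)%E ->
  measurable_fun setT g -> (forall x, 0 <= g x) ->
  (\int[mu1]_t (X1 t * g (xi1 t))%:E = \int[mu2]_t (X2 t * g (xi2 t))%:E)%E.
Proof.
move=> law mg g0.
have mG : measurable_fun setT (EFin \o g) by exact/measurable_EFinP.
rewrite (integral_comp_lim _ mX1 X10 mxi1 mG) // (integral_comp_lim _ mX2 X20 mxi2 mG) //.
congr (limn _); apply/funext => n.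
rewrite integral_comp_nnsfun // integral_comp_nnsfun //.
by apply: eq_fsbigr => r _; rewrite law.
Qed.

End SameLaw.

(** * The product rule for independent variables *)

Section Independence.
Context (d : measure_display) (T : measurableType d) (R : realType).
Local Open Scope ereal_scope.
Variables (P : probability T R) (k : nat) (xi : 'I_k -> T -> R).
Hypothesis mxi : forall i, measurable_fun setT (xi i).
Hypothesis indep : forall B : 'I_k -> set R, (forall i, measurable (B i)) ->
  P (\bigcap_(i in [set: 'I_k]) (xi i @^-1` B i)) = \prod_(i < k) P (xi i @^-1` B i).

(* Product rule with general functions in the first [n] coordinates and indicators in the others:
   the coordinates are replaced one at a time. *)
Lemma indep_integral_prod_rec n (g : 'I_k -> R -> R) (c : 'I_k -> R) :
  (forall i, measurable_fun setT (g i)) -> (forall i x, 0 <= g i x)%R ->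
  (forall i, \int[P]_t (g i (xi i t))%:E = (c i)%:E) ->
  (forall i : 'I_k, (n <= i)%N -> exists2 B : set R, measurable B & g i = \1_B) ->
  \int[P]_t (\prod_(i < k) g i (xi i t))%:E = (\prod_(i < k) c i)%:E.
Proof.
elim: n g c => [|n IH] g c mg g0 gc ind.
  have /choice[B HB] : forall i, exists B : set R, measurable B /\ g i = \1_B.
    by move=> i; have [B mB gB] := ind i (leq0n _); exists B.
  have mpre i : measurable (xi i @^-1` B i).
    by rewrite -[_ @^-1` _]setTI; apply: mxi => //; case: (HB i).
  have -> : \int[P]_t (\prod_(i < k) g i (xi i t))%:E =
    \int[P]_t (\1_(\bigcap_(i in [set: 'I_k]) (xi i @^-1` B i)) t)%:E.
    apply: eq_integral => t _; congr (_%:E); rewrite indicE.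
    have [tB|tB] := boolP (t \in _).
      rewrite big1// => i _; have [_ ->] := HB i.
      by rewrite indicE mem_set//; move: tB; rewrite inE => /(_ i I).
    move: tB; rewrite notin_setE => tB.
    have [i ti] : exists i, ~ (xi i @^-1` B i) t.
      apply/existsNP => H; apply: tB => i _; exact: H.
    rewrite (bigD1 i)//=; have [_ ->] := HB i.
    by rewrite indicE memNset// mul0r.
  rewrite integral_indic//; last first.
    by apply: fin_bigcap_measurable => //; exact: finite_finset.
  rewrite setIT; apply: etrans (indep _) _; first by move=> i; case: (HB i).
  rewrite -prodEFin; apply: eq_bigr => i _; rewrite -gc.
  have [_ ->] := HB i.
  have -> : \int[P]_t (\1_(B i) (xi i t))%:E = \int[P]_t (\1_(xi i @^-1` B i) t)%:E by [].
  by rewrite integral_indic// setIT.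
have [kn|nk] := leqP k n.
  by apply: IH => // i ni; move: (ltn_ord i); rewrite ltnNge (leq_trans kn ni).
pose i0 := Ordinal nk.
pose C := (\prod_(i < k | i != i0) c i)%R.
have c0 i : (0 <= c i)%R.
  by rewrite -lee_fin -gc integral_ge0// => t _; rewrite lee_fin.
have C0 : (0 <= C)%R by apply: prodr_ge0.
pose X t := (\prod_(i < k | i != i0) g i (xi i t))%R.
have mX : measurable_fun setT X.
  rewrite (_ : X = fun t => (\prod_(i < k) (if i != i0 then g i (xi i t) else 1))%R); last first.
    by apply/funext => t; rewrite /X big_mkcond.
  by apply: measurable_prod => i _; case: (i != i0) => //; exact: measurableT_comp.
have law (B : set R) : measurable B ->
    \int[P]_t (X t * \1_B (xi i0 t))%:E = \int[P]_t (C * \1_B (xi i0 t))%:E.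
  move=> mB.
  have mpre : measurable (xi i0 @^-1` B) by rewrite -[_ @^-1` _]setTI; exact: mxi.
  pose g' i := if i == i0 then \1_B : R -> R else g i.
  pose c' i := if i == i0 then fine (P (xi i0 @^-1` B)) else c i.
  have Pfin : P (xi i0 @^-1` B) \is a fin_num by exact: fin_num_measure.
  transitivity (\int[P]_t (\prod_(i < k) g' i (xi i t))%:E).
    apply: eq_integral => t _; congr (_%:E).
    rewrite [RHS](bigD1 i0)//= mulrC /g' eqxx; congr (_ * _)%R.
    by apply: eq_bigr => i /negbTE ->.
  rewrite (IH g' c').
  - under [RHS]eq_integral do rewrite EFinM.
    rewrite ge0_integralZl//; last first.
      by apply/measurable_EFinP; apply: measurableT_comp => //; exact: measurable_indic.
    have -> : \int[P]_t (\1_B (xi i0 t))%:E = \int[P]_t (\1_(xi i0 @^-1` B) t)%:E by [].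
    rewrite integral_indic// setIT (bigD1 i0)//= {1}/c' eqxx muleC EFinM fineK//.
    by congr (_ * (_)%:E)%E; apply: eq_bigr => i /negbTE; rewrite /c' => ->.
  - by move=> i; rewrite /g'; case: ifP => // _; exact: measurable_indic.
  - by move=> i x; rewrite /g'; case: ifP.
  - move=> i; rewrite /g' /c'; case: eqP => [->|//].
    have -> : \int[P]_t (\1_B (xi i0 t))%:E = \int[P]_t (\1_(xi i0 @^-1` B) t)%:E by [].
    by rewrite integral_indic// setIT fineK.
  - move=> i ni; rewrite /g'; case: eqP => [_|/eqP ne]; first by exists B.
    by apply: ind; rewrite ltn_neqAle ni andbT eq_sym; apply: contra ne => /eqP e; apply/eqP/val_inj.
have -> : \int[P]_t (\prod_(i < k) g i (xi i t))%:E = \int[P]_t (X t * g i0 (xi i0 t))%:E.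
  by apply: eq_integral => t _; rewrite (bigD1 i0)//= mulrC.
rewrite (eq_weighted_law mX _ _ _ _ _ law) //; last by move=> t; apply: prodr_ge0.
under eq_integral do rewrite EFinM.
rewrite ge0_integralZl//; last 2 first.
- by apply/measurable_EFinP; exact: measurableT_comp.
- by move=> t _; rewrite lee_fin.
by rewrite gc -EFinM [in RHS](bigD1 i0)//= mulrC.
Qed.

Lemma indep_integral_prod (g : 'I_k -> R -> R) (c : 'I_k -> R) :
  (forall i, measurable_fun setT (g i)) -> (forall i x, 0 <= g i x)%R ->
  (forall i, \int[P]_t (g i (xi i t))%:E = (c i)%:E) ->
  \int[P]_t (\prod_(i < k) g i (xi i t))%:E = (\prod_(i < k) c i)%:E.
Proof.
move=> mg g0 gc; apply: (@indep_integral_prod_rec k) => // i ki.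
by move: (ltn_ord i); rewrite ltnNge ki.
Qed.

End Independence.

(** * Exponential moments of Gaussian variables *)

Section GaussianMoments.
Variable R : realType.

Lemma gauss_square (s c x : R) : s != 0 ->
  - (x - 0) ^+ 2 / (s ^+ 2 *+ 2) + c * x =
  c ^+ 2 * s ^+ 2 / 2 + - (x - c * s ^+ 2) ^+ 2 / (s ^+ 2 *+ 2).
Proof. by move=> s0; field; rewrite s0. Qed.

(** Completing the square turns the tilted density into a constant multiple of the normal density
    with mean [c * s^2]. *)
Lemma integral_normal_mgf (s c : R) : 0 < s ->
  (\int[lebesgue_measure]_x (normal_pdf 0 s x * expR (c * x))%:E)%E =
  (expR (c ^+ 2 * s ^+ 2 / 2))%:E.
Proof.
move=> s0; have sn0 : s != 0 by rewrite gt_eqF.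
transitivity (\int[lebesgue_measure]_x ((expR (c ^+ 2 * s ^+ 2 / 2))%:E * (normal_pdf (c * s ^+ 2) s x)%:E))%E.
  apply: eq_integral => x _; rewrite -EFinM; congr (_%:E).
  rewrite !normal_pdfE // /normal_fun [RHS]mulrCA -[LHS]mulrA; congr (_ * _).
  by rewrite -!expRD gauss_square.
rewrite ge0_integralZl//; last 2 first.
- by apply/measurable_EFinP; exact: measurable_normal_pdf.
- by move=> x _; rewrite lee_fin normal_pdf_ge0.
by rewrite integral_normal_pdf mule1.
Qed.

Lemma normal_mgf (d : measure_display) (T : measurableType d) (P : probability T R)
    (xi : T -> R) (s c : R) : 0 < s -> measurable_fun setT xi ->
  (forall B : set R, measurable B -> P (xi @^-1` B) = normal_prob 0 s B) ->
  (\int[P]_t (expR (c * xi t))%:E)%E = (expR (c ^+ 2 * s ^+ 2 / 2))%:E.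
Proof.
move=> s0 mxi law; rewrite -integral_normal_mgf //.
transitivity (\int[P]_t (1 * expR (c * xi t))%:E)%E.
  by apply: eq_integral => t _; rewrite mul1r.
apply: (@eq_weighted_law _ _ _ _ _ _ _ P (fun=> 1) xi lebesgue_measure (normal_pdf 0 s) id
          _ _ _ _ _ _ (fun x => expR (c * x))) => //.
- exact: measurable_normal_pdf.
- exact: normal_pdf_ge0.
- move=> B mB; under eq_integral do rewrite mul1r.
  have mpre : measurable (xi @^-1` B) by rewrite -[_ @^-1` _]setTI; exact: mxi.
  have -> : (\int[P]_t (\1_B (xi t))%:E = \int[P]_t (\1_(xi @^-1` B) t)%:E)%E by [].
  rewrite integral_indic// setIT; apply: etrans (law _ mB) _.
  rewrite /normal_prob [LHS]integral_mkcond; apply: eq_integral => x _.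
  by rewrite patchE indicE; case: ifP; rewrite ?mulr1 ?mulr0.
- by apply: measurableT_comp => //; exact: measurable_funM.
Qed.

(** A single term of the exponential series at [|x|]; it reads even moments off two exponential
    moments. *)
Lemma pow_le_expR (x : R) Q : x ^+ Q.*2 <= (Q.*2)`!%:R * (expR x + expR (- x)).
Proof.
case: Q => [|Q].
  rewrite double0 expr0 fact0 mul1r.
  have [x0|x0] := leP 0 x.
    by have := expR_ge1Dx x; have := expR_ge0 (- x); lra.
  by have := expR_ge1Dx (- x); have := expR_ge0 x; lra.
have E : x ^+ Q.+1.*2 = `|x| ^+ Q.+1.*2 by rewrite -normrX ger0_norm// exprn_even_ge0 // odd_double.
have h := expR_ge1Dxn Q.*2.+1 (normr_ge0 x).
have F0 : (0 : R) < (Q.+1.*2)`!%:R by rewrite ltr0n fact_gt0.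
have h2 : expR `|x| <= expR x + expR (- x).
  have [x0|x0] := leP 0 x; first by rewrite ger0_norm // lerDl expR_ge0.
  by rewrite ltr0_norm // lerDr expR_ge0.
rewrite E -ler_pdivrMl // mulrC; rewrite doubleS in h *; lra.
Qed.

End GaussianMoments.

(** * Rules for bounding moments *)

Section MomentCalculus.
Context (d : measure_display) (T : measurableType d) (R : realType) (P : probability T R).

(** Measurability and sign travel with the bound, because additivity of the integral asks for both
    at each use. *)
Definition mom_le (X : T -> R) (c : R) : Prop :=
  [/\ measurable_fun setT X, forall w, 0 <= X w & (\int[P]_w (X w)%:E <= c%:E)%E].

Lemma mom_le_cst (c : R) : 0 <= c -> mom_le (fun=> c) c.
Proof.
move=> c0; split => //; rewrite integral_cst//.
by rewrite [X in (_ * X)%E](_ : _ = 1%E) ?mule1 //; exact: probability_setT.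
Qed.

Lemma mom_leD X Y a b : mom_le X a -> mom_le Y b -> mom_le (fun w => X w + Y w) (a + b).
Proof.
move=> [mX X0 Xa] [mY Y0 Yb]; split; first exact: measurable_funD.
  by move=> w; rewrite addr_ge0.
under eq_integral do rewrite EFinD.
rewrite ge0_integralD//; last 4 first.
- by move=> w _; rewrite lee_fin.
- exact/measurable_EFinP.
- by move=> w _; rewrite lee_fin.
- exact/measurable_EFinP.
by rewrite EFinD; exact: leeD.
Qed.

Lemma mom_leZ X a k : 0 <= k -> mom_le X a -> mom_le (fun w => k * X w) (k * a).
Proof.
move=> k0 [mX X0 Xa]; split; first exact: measurable_funM.
  by move=> w; rewrite mulr_ge0.
under eq_integral do rewrite EFinM.
rewrite ge0_integralZl//; last 2 first.
- exact/measurable_EFinP.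
- by move=> w _; rewrite lee_fin.
by rewrite EFinM; apply: lee_wpmul2l => //; rewrite lee_fin.
Qed.

Lemma mom_le_mono (X Y : T -> R) c : measurable_fun setT X -> (forall w, 0 <= X w <= Y w) ->
  mom_le Y c -> mom_le X c.
Proof.
move=> mX XY [mY Y0 Yc]; split => //; first by move=> w; case/andP: (XY w).
apply: le_trans Yc; apply: le_integral_pointwise => w; rewrite lee_fin;
  by case/andP: (XY w).
Qed.

Lemma mom_le_weak X a b : a <= b -> mom_le X a -> mom_le X b.
Proof.
by move=> ab [mX X0 Xa]; split => //; apply: le_trans Xa _; rewrite lee_fin.
Qed.

Lemma mom_le_sum n (X : 'I_n -> T -> R) (c : 'I_n -> R) :
  (forall j, mom_le (X j) (c j)) -> mom_le (fun w => \sum_(j < n) X j w) (\sum_(j < n) c j).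
Proof.
elim: n X c => [|n IH] X c H.
  rewrite big_ord0; under eq_fun do rewrite big_ord0.
  exact: mom_le_cst.
rewrite big_ord_recr /=; under eq_fun do rewrite big_ord_recr /=.
by apply: mom_leD => //; apply: IH.
Qed.

Lemma mom_le_powD X Y a b Q : mom_le (fun w => X w ^+ Q) a -> mom_le (fun w => Y w ^+ Q) b ->
  measurable_fun setT X -> measurable_fun setT Y -> (forall w, 0 <= X w) -> (forall w, 0 <= Y w) ->
  mom_le (fun w => (X w + Y w) ^+ Q) (2 ^+ Q * (a + b)).
Proof.
move=> Xa Yb mX mY X0 Y0.
apply: mom_le_mono (mom_leZ _ (mom_leD Xa Yb)) => //.
- by apply: measurable_funX; exact: measurable_funD.
- by move=> w; rewrite exprn_ge0 ?addr_ge0 //= powD_le.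
Qed.

(** The squared gradient is the sum of [lam_j^2 * Z_j^2] with weights [1 / lam_j] of total mass at
    most [8], so Jensen reduces its moments to those of single modes. It serves both the noise and
    [Y]. *)
Lemma mom_le_gradsq N (Z : nat -> T -> R) (K : R) Q : (2 <= N)%N -> 0 <= K ->
  (forall j, (j < N)%N -> measurable_fun setT (Z j)) ->
  (forall j, (0 < j < N)%N -> mom_le (fun w => (Z j w ^+ 2) ^+ Q.+1) (K * (lamN R N j ^- 2) ^+ Q.+1)) ->
  mom_le (fun w => gradsq N (fun j => Z j w) ^+ Q.+1) (8 ^+ Q.+1 * K).
Proof.
move=> N2 K0 mZ H.
have l0 j : 0 <= (lamN R N j)^-1 by rewrite invr_ge0 lamN_ge0.
have mgr : measurable_fun setT (fun w => gradsq N (fun j => Z j w)).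
  apply: measurable_sum => j; apply: measurable_funM => //.
  by apply: measurable_funX; exact: mZ.
pose W := \sum_(j < N) (lamN R N j)^-1.
have W8 : W <= 8 := sum_inv_lamN R N2.
have W0 : 0 <= W by apply: sumr_ge0.
have HS : mom_le (fun w => \sum_(j < N) (lamN R N j)^-1 * (lamN R N j ^+ 2 * Z j w ^+ 2) ^+ Q.+1)
   (\sum_(j < N) (lamN R N j)^-1 * K).
  apply: mom_le_sum => -[[|j] jN] /=.
    rewrite lamN0 invr0 mul0r; under eq_fun do rewrite mul0r.
    exact: mom_le_cst.
  have lj : lamN R N j.+1 != 0 by rewrite gt_eqF // lamN_gt0.
  have := mom_leZ (exprn_ge0 Q.+1 (sqr_ge0 (lamN R N j.+1))) (H j.+1 jN).
  have -> : (lamN R N j.+1 ^+ 2) ^+ Q.+1 * (K * lamN R N j.+1 ^- 2 ^+ Q.+1) = K.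
    by rewrite mulrCA -exprMn mulfV ?expr1n ?mulr1 // expf_neq0.
  under eq_fun do rewrite -exprMn.
  exact: mom_leZ.
have := mom_leZ (exprn_ge0 Q W0) HS.
have -> : W ^+ Q * \sum_(j < N) (lamN R N j)^-1 * K = W ^+ Q.+1 * K.
  by rewrite -mulr_suml mulrA -exprSr.
move=> HS2; apply: mom_le_weak (mom_le_mono _ _ HS2).
- by apply: ler_wpM2r => //; rewrite lerXn2r ?nnegrE.
- exact: measurable_funX.
- move=> w; rewrite exprn_ge0 ?gradsq_ge0 //=.
  have -> : gradsq N (fun j => Z j w) = \sum_(j < N) (lamN R N j)^-1 * (lamN R N j ^+ 2 * Z j w ^+ 2).
    apply: eq_bigr => j _; have [->|lj] := eqVneq (lamN R N j) 0; first by rewrite invr0 !mul0r.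
    by move: (lamN R N j) lj => l lj; field.
  by apply: jensen_pow => // j; rewrite mulr_ge0 ?sqr_ge0.
Qed.

(** Convexity of the power keeps the moment of [X] below the common bound for the forcing [Y]. The
    forcing is constrained only before time [m], as strong induction on [m] will require. *)
Lemma mom_le_contract (X Y : nat -> T -> R) (k K : R) Q m : 0 <= k <= 1 ->
  (forall n, measurable_fun setT (X n)) -> (forall n w, 0 <= X n w) -> (forall n w, 0 <= Y n w) ->
  (forall w, X 0%N w = 0) ->
  (forall n w, X n.+1 w <= (1 - k) * X n w + k * Y n w) -> 0 <= K ->
  (forall n, (n < m)%N -> mom_le (fun w => Y n w ^+ Q.+1) K) ->
  mom_le (fun w => X m w ^+ Q.+1) K.
Proof.
move=> k01 mX X0 Y0 X00 rec K0; have /andP[k0 k1] := k01.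
elim: m => [|m IH] HY.
  apply: (mom_le_mono _ _ (mom_le_cst K0)); first exact: measurable_funX.
  by move=> w; rewrite X00 expr0n /= lexx.
have Hm := IH (fun n nm => HY n (ltnW nm)).
have k1' : 0 <= 1 - k by rewrite subr_ge0.
have := mom_leD (mom_leZ k1' Hm) (mom_leZ k0 (HY m (ltnSn m))).
rewrite -mulrDl subrK mul1r => H; apply: mom_le_mono H; first exact: measurable_funX.
move=> w; rewrite exprn_ge0 //=; apply: le_trans (convex_pow Q k01 (X0 _ _) (Y0 _ _)).
rewrite lerXn2r ?nnegrE // addr_ge0 // mulr_ge0 //.
Qed.

End MomentCalculus.

(** * The discrete stochastic convolution *)

Section Noise.
Context (d : measure_display) (T : measurableType d) (R : realType) (P : probability T R).
Variable beta : nat -> R -> T -> R.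
Hypothesis BM : indep_std_BMs P beta.

Definition incr (tau : R) (j k : nat) (w : T) : R :=
  beta j (k.+1%:R * tau) w - beta j (k%:R * tau) w.

Lemma measurable_incr (tau : R) j k : 0 < tau -> (0 < j)%N -> measurable_fun setT (incr tau j k).
Proof.
move=> t0 j0; case: BM => mb _ _ _ _.
by apply: measurable_funB; apply: mb => //; rewrite mulr_ge0 // ltW.
Qed.

Lemma preimage_memE (f : T -> R) (B : set R) : [set w | f w \in B] = f @^-1` B.
Proof. by apply/seteqP; split => w /=; rewrite inE. Qed.

Lemma incr_lt (tau : R) k : 0 < tau -> k%:R * tau < k.+1%:R * tau.
Proof. by move=> t0; rewrite ltr_pM2r // ltr_nat. Qed.

Lemma incr_mgf (tau : R) j k c : 0 < tau -> (0 < j)%N ->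
  (\int[P]_w (expR (c * incr tau j k w))%:E = (expR (c ^+ 2 * tau / 2))%:E)%E.
Proof.
move=> t0 j0; case: BM => _ _ _ law _.
rewrite (@normal_mgf R d T P _ (Num.sqrt tau)).
- by rewrite sqr_sqrtr // ltW.
- by rewrite sqrtr_gt0.
- exact: measurable_incr.
move=> B mB; have := law j (k%:R * tau) (k.+1%:R * tau) j0 _ (incr_lt k t0) B mB.
rewrite preimage_memE => ->; last by rewrite mulr_ge0 // ltW.
by rewrite -mulrBl -natr1 addrAC subrr add0r mul1r.
Qed.

Lemma incr_sum_mgf (tau : R) j m (a : nat -> R) : 0 < tau -> (0 < j)%N ->
  (\int[P]_w (expR (\sum_(k < m) a k * incr tau j k w))%:E =
   (expR (\sum_(k < m) a k ^+ 2 * tau / 2))%:E)%E.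
Proof.
move=> t0 j0; have [_ _ _ _ ind] := BM.
under eq_integral do rewrite expR_sum.
rewrite expR_sum.
apply: (@indep_integral_prod _ _ _ P m (fun i => incr tau j i) _ _ (fun i x => expR (a i * x))
   (fun i => expR (a i ^+ 2 * tau / 2))).
- by move=> i; exact: measurable_incr.
- move=> B mB.
  have := ind m (fun=> j) (fun i => i%:R * tau) (fun i => i.+1%:R * tau) B.
  under eq_bigcapr do rewrite preimage_memE.
  under eq_bigr do rewrite preimage_memE.
  apply.
  + by move=> i; split => //; [rewrite mulr_ge0 // ltW|exact: incr_lt].
  + move=> i i' ii' _; rewrite !ler_pM2r // !ler_nat.
    by have := ii'; rewrite -val_eqE /= neq_ltn => /orP[]; [left|right].
- by move=> i; apply: measurableT_comp => //; exact: measurable_funM.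
- by move=> i x; exact: expR_ge0.
- by move=> i; exact: incr_mgf.
Qed.

Fixpoint noise (N : nat) (sigma tau : R) (w : T) (m j : nat) : R :=
  if m is m'.+1 then expR (- lamN R N j ^+ 2 * tau) *
    (noise N sigma tau w m' j + sigma * (if j == 0%N then 0 else incr tau j m' w))
  else 0.

Lemma noise0 N sigma tau w m : noise N sigma tau w m 0 = 0.
Proof. by elim: m => [//|m IH] /=; rewrite IH mulr0 addr0 mulr0. Qed.

Lemma noiseE N sigma tau w m j : (0 < j)%N ->
  noise N sigma tau w m j = \sum_(k < m) sigma * expR (- lamN R N j ^+ 2 * tau) ^+ (m - k) * incr tau j k w.
Proof.
move=> j0; elim: m => [|m IH]; first by rewrite big_ord0.
rewrite /= IH big_ord_recr /= subSnn expr1 gtn_eqF // mulrDr mulr_sumr; congr (_ + _).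
  by apply: eq_bigr => k _; rewrite subSn 1?ltnW // [_ ^+ (m - k).+1]exprS; ring.
by ring.
Qed.

Lemma measurable_noise N (sigma tau : R) m j : 0 < tau ->
  measurable_fun setT (fun w => noise N sigma tau w m j).
Proof.
move=> t0; elim: m => [|m IH] /=; first exact: measurable_cst.
apply: measurable_funM => //; apply: measurable_funD => //; apply: measurable_funM => //.
by case: eqP => [_|/eqP j0]; [exact: measurable_cst|apply: measurable_incr => //; rewrite lt0n].
Qed.

(** The hypothesis is [e^2 / (1 - e^2) <= 1 / (2 * x)] without division. The exponents run from [1]
    to [m], since the scheme damps even the newest increment once. *)
Lemma geometric_le (e x : R) m : 0 < x -> e ^+ 2 * (1 + 2 * x) <= 1 ->
  \sum_(k < m) (e ^+ (m - k)) ^+ 2 <= (2 * x)^-1.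
Proof.
move=> x0 ex; elim: m => [|m IH]; first by rewrite big_ord0 invr_ge0 mulr_ge0 // ltW.
rewrite big_ord_recr /= subSnn expr1.
have -> : \sum_(k < m) (e ^+ (m.+1 - k)) ^+ 2 = e ^+ 2 * \sum_(k < m) (e ^+ (m - k)) ^+ 2.
  by rewrite mulr_sumr; apply: eq_bigr => k _; rewrite subSn 1?ltnW // [e ^+ (m - k).+1]exprS exprMn.
have h := ler_wpM2l (sqr_ge0 e) IH.
apply: (@le_trans _ _ (e ^+ 2 * (1 + 2 * x) * (2 * x)^-1)).
  have -> : e ^+ 2 * (1 + 2 * x) * (2 * x)^-1 = e ^+ 2 * (2 * x)^-1 + e ^+ 2.
    by field; rewrite gt_eqF.
  by rewrite lerD2r.
by rewrite ler_piMl // invr_ge0 mulr_ge0 // ltW.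
Qed.

(** The mode has standard deviation of order [1 / l], so the exponential moments are taken at [l]
    and [-l]. There the Gaussian exponent is at most [l^2 * sigma^2 * tau / 2] times
    [1 / (2 * l^2 * tau)], that is [sigma^2 / 4], whatever [m], [tau] and [N] are. *)
Lemma noise_moment N (sigma tau : R) m j Q : (2 <= N)%N -> 0 < tau -> (0 < j < N)%N ->
  mom_le P (fun w => (noise N sigma tau w m j ^+ 2) ^+ Q)
    ((Q.*2)`!%:R * (2 * expR (sigma ^+ 2 / 4)) * (lamN R N j ^- 2) ^+ Q).
Proof.
move=> N2 t0 jN; have l0 := lamN_gt0 R N2 jN; have /andP[j0 _] := jN.
set l := lamN R N j in l0 *.
have mgf (s : R) : s ^+ 2 = l ^+ 2 ->
    mom_le P (fun w => expR (s * noise N sigma tau w m j)) (expR (sigma ^+ 2 / 4)).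
  move=> sl; split; first by apply: measurableT_comp => //; apply: measurable_funM => //; exact: measurable_noise.
    by move=> w; exact: expR_ge0.
  pose e := expR (- l ^+ 2 * tau).
  have -> : (\int[P]_w (expR (s * noise N sigma tau w m j))%:E =
    \int[P]_w (expR (\sum_(k < m) (s * sigma * e ^+ (m - k)) * incr tau j k w))%:E)%E.
    apply: eq_integral => w _; rewrite noiseE // mulr_sumr; congr (expR _)%:E.
    by apply: eq_bigr => k _; rewrite /e; ring.
  rewrite (@incr_sum_mgf tau j m (fun k => s * sigma * e ^+ (m - k))) // lee_fin ler_expR.
  have x0 : 0 < l ^+ 2 * tau by rewrite mulr_gt0 // exprn_gt0.
  have ex : e ^+ 2 * (1 + 2 * (l ^+ 2 * tau)) <= 1.
    have -> : e ^+ 2 = expR (- (2 * (l ^+ 2 * tau))) by rewrite /e -expRM_natl; congr expR; ring.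
    rewrite -[leRHS](expRxMexpNx_1 (- (2 * (l ^+ 2 * tau)))) opprK ler_wpM2l ?expR_ge0 //.
    exact: expR_ge1Dx.
  have g := geometric_le m x0 ex.
  have -> : \sum_(k < m) (s * sigma * e ^+ (m - k)) ^+ 2 * tau / 2 =
    l ^+ 2 * sigma ^+ 2 * tau / 2 * \sum_(k < m) (e ^+ (m - k)) ^+ 2.
    by rewrite mulr_sumr; apply: eq_bigr => k _; rewrite -sl; ring.
  have c0 : 0 <= l ^+ 2 * sigma ^+ 2 * tau / 2.
    by rewrite divr_ge0 // mulr_ge0 ?(ltW t0) // mulr_ge0 ?sqr_ge0.
  apply: le_trans (ler_wpM2l c0 g) _.
  rewrite [leLHS](_ : _ = sigma ^+ 2 / 4) //.
  by field; rewrite !gt_eqF.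
have H := mom_leD (mgf l erefl) (mgf (- l) (sqrrN l)).
have := mom_leZ (ler0n R (Q.*2)`!) H.
move=> /(mom_leZ (exprn_ge0 Q (sqr_ge0 l^-1))) H2.
apply: (mom_le_weak _ (mom_le_mono _ _ H2)).
- by rewrite -exprVn -mulr2n -[expR _ *+ 2]mulr_natl mulrC.
- by apply: measurable_funX; apply: measurable_funX; exact: measurable_noise.
- move=> w; rewrite exprn_ge0 ?sqr_ge0 //=.
  set n := noise _ _ _ _ _ _.
  have := pow_le_expR (l * n) Q.
  have -> : (l * n) ^+ Q.*2 = (l ^+ 2) ^+ Q * (n ^+ 2) ^+ Q.
    by rewrite -exprMn -exprMn -exprM mul2n.
  rewrite mulNr exprVn exprVn -ler_pdivlMl //; last by rewrite exprn_gt0 // exprn_gt0.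
Qed.

End Noise.

(** * Uniform discrete norms of the initial datum *)

Section InitialDatum.
Variable R : realType.

Lemma itv0S (x y : R) : x <= y -> itv0 x `<=` itv0 y.
Proof.
move=> xy z; rewrite /itv0 /= !in_itv /= => /andP[-> zx] /=; exact: le_trans xy.
Qed.

Lemma measurable_itv0 (x : R) : measurable (itv0 x).
Proof. exact: measurable_itv. Qed.

(* This is [(g - c)^2 >= 0] integrated over [[a, b]]; [G x] is the integral of [g^2] over [[0, x]]. *)
Lemma in_H1_young (u0 : R -> R) : in_H1 u0 -> exists G : R -> R,
  (forall x, 0 <= x <= pi -> 0 <= G x) /\
  (forall a b c, 0 <= a -> a <= b -> b <= pi ->
     2 * c * (u0 b - u0 a) <= c ^+ 2 * (b - a) + (G b - G a)).
Proof.
move=> [g [mg g2 ug]].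
have ppi := pi_ge0 R.
have mgx x : x <= pi -> measurable_fun (itv0 x) g.
  by move=> xp; apply: measurable_funS mg; [exact: measurable_itv0|exact: itv0S].
have mg2 x : x <= pi -> measurable_fun (itv0 x) (fun y => g y ^+ 2).
  by move=> xp; apply: measurable_funX; exact: mgx.
have ig2 x : x <= pi -> lebesgue_measure.-integrable (itv0 x) (fun y => (g y ^+ 2)%:E).
  move=> xp; apply/integrableP; split; first by apply/measurable_EFinP; exact: mg2.
  under eq_integral do rewrite /= ger0_norm ?sqr_ge0 //.
  apply: le_lt_trans g2; apply: ge0_subset_integral => //.
  - exact: measurable_itv0.
  - exact: measurable_itv0.
  - by apply/measurable_EFinP; exact: mg2.
  - by move=> y _; rewrite lee_fin sqr_ge0.
  - exact: itv0S.
have mu (x : R) : 0 <= x -> lebesgue_measure (itv0 x) = x%:E.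
  move=> x0; rewrite /itv0 lebesgue_measure_itv /= lte_fin.
  by have [x0'|x0'] := ltP 0 x; [rewrite oppr0 adde0|congr (_%:E); apply/le_anti; rewrite x0 x0'].
pose G x := fine (\int[lebesgue_measure]_(y in itv0 x) (g y ^+ 2)%:E)%E.
have GE x : x <= pi -> (\int[lebesgue_measure]_(y in itv0 x) (g y ^+ 2)%:E = (G x)%:E)%E.
  by move=> xp; rewrite fineK //; apply: integrable_fin_num; [exact: measurable_itv0|exact: ig2].
have KE c x : 0 <= x <= pi ->
  (\int[lebesgue_measure]_(y in itv0 x) ((g y - c) ^+ 2)%:E =
   (G x + c ^+ 2 * x - 2 * c * (u0 x - u0 0))%:E)%E.
  move=> /andP[x0 xp]; have [ig ugx] := ug x (introT andP (conj x0 xp)).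
  have ic : lebesgue_measure.-integrable (itv0 x) (fun=> (c ^+ 2)%:E).
    apply/integrableP; split; first exact: measurable_cst.
    rewrite integral_cst; last exact: measurable_itv0.
    by rewrite [X in (_ * X)%E](_ : _ = x%:E) ?ltry //; exact: mu.
  transitivity (\int[lebesgue_measure]_(y in itv0 x) (((g y ^+ 2)%:E + (c ^+ 2)%:E) + (- (2 * c))%:E * (g y)%:E))%E.
    by apply: eq_integral => y _; rewrite -EFinM -!EFinD; congr (_%:E); ring.
  rewrite integralD //; [|exact: measurable_itv0| |].
  - rewrite integralD //; [|exact: measurable_itv0|exact: ig2].
    rewrite integralZl //; [|exact: measurable_itv0].
    rewrite ugx GE // integral_cst; last exact: measurable_itv0.
    by rewrite [X in (_ + _ * X + _)%E](_ : _ = x%:E) -?EFinM -?EFinD ?mulNr //; exact: mu.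
  - by apply: integrableD => //; [exact: measurable_itv0|exact: ig2].
  - by apply: integrableZl => //; exact: measurable_itv0.
exists G; split.
  move=> x /andP[x0 xp]; rewrite /G fine_ge0 // integral_ge0 // => y _.
  by rewrite lee_fin sqr_ge0.
move=> a b c a0 ab bp.
have b0 : 0 <= b by exact: le_trans ab.
have ap : a <= pi by exact: le_trans bp.
have := @ge0_subset_integral _ _ R lebesgue_measure (itv0 a) (itv0 b) (measurable_itv0 a)
  (measurable_itv0 b) (fun y => ((g y - c) ^+ 2)%:E).
rewrite !KE ?b0 ?a0 // lee_fin => H.
suff : G a + c ^+ 2 * a - 2 * c * (u0 a - u0 0) <= G b + c ^+ 2 * b - 2 * c * (u0 b - u0 0) by lra.
apply: H.
- apply/measurable_EFinP; apply: measurable_funX; apply: measurable_funB; first exact: mgx.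
  exact: measurable_cst.
- by move=> y _; rewrite lee_fin sqr_ge0.
- exact: itv0S.
Qed.

Lemma xN_ge0 N i : 0 <= xN R N i.
Proof. by rewrite /xN /hN mulr_ge0 // ?addr_ge0 // divr_ge0 // pi_ge0. Qed.

Lemma xN_le_pi N i : (2 <= N)%N -> (i < N)%N -> xN R N i <= pi.
Proof.
move=> N2 iN; rewrite /xN -(hNN R N2) ler_wpM2r ?(ltW (hN_gt0 R N2)) //.
have : i.+1%:R <= N%:R :> R by rewrite ler_nat.
by rewrite -natr1; lra.
Qed.

Lemma xNS N i : xN R N i.+1 = xN R N i + hN R N.
Proof. by rewrite /xN -natr1; ring. Qed.

(** Three choices of the free constant in [in_H1_young] suffice: [0] makes [G] monotone, [1] and
    [-1] bound [u0] uniformly, and the difference quotient on a cell bounds the energy of that cell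
    by the increment of [G], which telescopes. *)
Lemma in_H1_w12 (u0 : R -> R) : in_H1 u0 -> exists2 D : R, 0 <= D &
  forall N, (2 <= N)%N -> w12sq N (coef N (fun i => u0 (xN R N i))) <= D.
Proof.
move=> /in_H1_young[G [G0 Gy]].
have pp := pi_ge0 R.
pose S := `|u0 0| + pi + G pi.
have Gpi : 0 <= G pi by apply: G0; rewrite pp lexx.
have S0 : 0 <= S by rewrite /S; nonneg.
have G00 : 0 <= G 0 by apply: G0; rewrite lexx pp.
have Gmono x : 0 <= x <= pi -> G x <= G pi.
  by move=> /andP[x0 xp]; have := Gy x pi 0 x0 xp (lexx _); rewrite expr0n !mulr0 !mul0r; lra.
have uS x : 0 <= x <= pi -> `|u0 x| <= S.
  move=> /andP[x0 xp].
  have h1 := Gy 0 x 1 (lexx _) x0 xp; have h2 := Gy 0 x (-1) (lexx _) x0 xp.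
  have := Gmono x (introT andP (conj x0 xp)); move=> h3.
  rewrite sqrrN expr1n in h2; rewrite expr1n in h1.
  have := ler_norm (u0 0); have := ler_norm (- u0 0); rewrite normrN => h4 h5.
  by rewrite /S ler_norml; apply/andP; split; lra.
exists (pi * S ^+ 2 + G pi); first by nonneg.
move=> N N2; set v := fun i => _.
have h0 := hN_gt0 R N2.
rewrite w12sqE; apply: lerD.
  have -> : l2sq N (coef N v) = l2ip N v v by rewrite (parseval N2); apply: eq_bigr => j _; rewrite expr2.
  have -> : pi * S ^+ 2 = hN R N * (N%:R * S ^+ 2) by rewrite -(hNN R N2) -mulrA mulrCA.
  rewrite /l2ip; apply: ler_wpM2l; first exact: ltW.
  apply: (@le_trans _ _ (\sum_(i < N) S ^+ 2)); last by rewrite sumr_const card_ord mulr_natl.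
  apply: ler_sum => i _; rewrite -expr2 -(real_normK (num_real (v i))) lerXn2r ?nnegrE //.
  by apply: uS; rewrite xN_ge0 xN_le_pi.
have -> : gradsq N (coef N v) = dform N v v.
  by rewrite (dform_coef N2); apply: eq_bigr => j _; rewrite expr2 mulrA.
apply: (@le_trans _ _ (\sum_(l < N.-1) (G (xN R N l.+1) - G (xN R N l)))); last first.
  rewrite -(big_mkord xpredT (fun l => G (xN R N l.+1) - G (xN R N l))) telescope_sumr //.
  have N0 : (N.-1 < N)%N by rewrite ltn_predL; exact: ltnW.
  have := G0 (xN R N 0) (introT andP (conj (xN_ge0 _ _) (xN_le_pi N2 (ltnW N2)))).
  have := Gmono (xN R N N.-1) (introT andP (conj (xN_ge0 _ _) (xN_le_pi N2 N0))).
  lra.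
rewrite /dform mulr_sumr; apply: ler_sum => l _.
have lN' : (l.+1 < N)%N by rewrite -ltn_predRL ltn_ord.
have ll : xN R N l <= xN R N l.+1 by rewrite xNS lerDl ltW.
have := Gy (xN R N l) (xN R N l.+1) ((hN R N)^-1 * (v l.+1 - v l)) (xN_ge0 _ _) ll (xN_le_pi N2 lN').
rewrite -/(v l.+1) -/(v l); set D := v l.+1 - v l.
have -> : xN R N l.+1 - xN R N l = hN R N by rewrite xNS addrAC subrr add0r.
have -> : ((hN R N)^-1 * D) ^+ 2 * hN R N = (hN R N)^-1 * (D * D).
  by move: (hN R N) h0 => h h0; field; rewrite gt_eqF.
lra.
Qed.

End InitialDatum.

(** * The maximum norm of the interpolant *)

Section Interpolation.
Variable R : realType.

(** The cells are disjoint, so at most one term of the sum survives, and it is a convex combination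
    of two neighbouring values. *)
Lemma PN_bound N (v : vec R) (M : R) x : (2 <= N)%N -> 0 <= M ->
  (forall i, (i < N)%N -> `|v i| <= M) -> `|PN N v x| <= M.
Proof.
move=> N2 M0 vM; have h0 := hN_gt0 R N2; rewrite /PN.
case: ifP => _; first by apply: vM; exact: ltnW.
case: ifP => _; first by apply: vM; rewrite ltn_predL; exact: ltnW.
have mono k l : (k <= l)%N -> xN R N k <= xN R N l.
  by move=> kl; rewrite /xN ler_pM2r // lerD2r ler_nat.
have [[k /andP[k1 k2]]|none] :=
    pselect (exists k : 'I_N.-1, (xN R N k <= x) && (x < xN R N k.+1)); last first.
  rewrite big1 ?normr0 // => k _; case: ifP => // kx; exfalso; apply: none; by exists k.
rewrite (bigD1 k) //= k1 k2 /= big1 ?addr0; last first.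
  move=> l lk; case: ifP => // /andP[l1 l2]; exfalso.
  have : (l < k)%N || (k < l)%N by rewrite -neq_ltn; apply: contra lk => /eqP e; apply/eqP/val_inj.
  by case/orP => /mono h; lra.
have kN : (k < N)%N by apply: leq_trans (ltn_ord k) (leq_pred N).
have kN' : (k.+1 < N)%N by rewrite -ltn_predRL ltn_ord.
pose t := (x - xN R N k) / hN R N.
have t0 : 0 <= t by rewrite divr_ge0 ?subr_ge0 // ltW.
have t1 : t <= 1 by rewrite ler_pdivrMr // mul1r; move: k2; rewrite xNS; lra.
rewrite -mulrA -/t.
have := vM _ kN; have := vM _ kN'; rewrite !ler_norml.
move: (v k) (v k.+1) => a b /andP[b1 b2] /andP[a1 a2].
have h1 : 0 <= (1 - t) * (M - a) by rewrite mulr_ge0; lra.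
have h2 : 0 <= (1 - t) * (M + a) by rewrite mulr_ge0; lra.
have h3 : 0 <= t * (M - b) by rewrite mulr_ge0; lra.
have h4 : 0 <= t * (M + b) by rewrite mulr_ge0; lra.
by apply/andP; split; lra.
Qed.

Lemma Linf_norm_PN N (v : vec R) (M : R) : (2 <= N)%N -> 0 <= M ->
  (forall i, (i < N)%N -> `|v i| <= M) -> 0 <= Linf_norm (PN N v) <= M.
Proof.
move=> N2 M0 vM; set A := [set y | exists2 x, 0 < x < pi & y = `|PN N v x|].
have ubA : ubound A M by move=> _ [x _ ->]; exact: PN_bound.
have A0 : A `|PN N v (pi / 2)|.
  by exists (pi / 2) => //; have := pi_gt0 R => ?; apply/andP; split; lra.
apply/andP; split.
  apply: le_trans (normr_ge0 (PN N v (pi / 2))) _.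
  by apply: ub_le_sup A0; exists M.
by apply: ge_sup => //; exists `|PN N v (pi / 2)|.
Qed.

End Interpolation.

(** * Scalar inequalities for one mode and for real exponents *)

Section ScalarSteps.
Variable R : realType.

(** With [x = l^2 * tau] and [u = f / l] the step is [e * y - e * x * u]. As [e * x <= 1 - e], the
    weights of [y] and [u] sum to at most [1], and convexity of the square applies. *)
Lemma mode_step (l tau y f : R) (e := expR (- l ^+ 2 * tau)) : 0 < l -> 0 < tau ->
  (e * (y - tau * l * f)) ^+ 2 <= e * y ^+ 2 + (1 - e) * (l ^- 2 * f ^+ 2).
Proof.
move=> l0 t0; pose x := l ^+ 2 * tau.
have x0 : 0 < x by rewrite mulr_gt0 // exprn_gt0.
have e0 : 0 < e := expR_gt0 _.
have ex : e * (1 + x) <= 1.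
  have -> : e = expR (- x) by rewrite /e mulNr.
  rewrite -[leRHS](expRxMexpNx_1 (- x)) opprK ler_wpM2l ?expR_ge0 //; exact: expR_ge1Dx.
pose u := f / l.
have -> : l ^- 2 * f ^+ 2 = u ^+ 2 by rewrite /u; field; rewrite gt_eqF.
have -> : e * (y - tau * l * f) = e * y - e * x * u.
  by rewrite /u /x; field; rewrite gt_eqF.
have p0 : 0 <= e * x by rewrite mulr_ge0 // ltW.
have pe : e * x <= 1 - e by lra.
set p := e * x in p0 pe *.
have h1 : 0 <= e * p * (y + u) ^+ 2 by rewrite mulr_ge0 ?sqr_ge0 // mulr_ge0 // ltW.
have h2 : 0 <= e * (1 - e - p) * y ^+ 2 by rewrite mulr_ge0 ?sqr_ge0 // mulr_ge0 ?(ltW e0) //; lra.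
have h3 : 0 <= (1 - e - p * (e + p)) * u ^+ 2.
  rewrite mulr_ge0 ?sqr_ge0 //; nra.
nra.
Qed.

Lemma sqrD_le (p q : R) : (p + q) ^+ 2 <= 2 * p ^+ 2 + 2 * q ^+ 2.
Proof. by have := sqr_ge0 (p - q); rewrite sqrrB sqrrD; lra. Qed.

Lemma powR_le_even (x p : R) Q : 0 <= x -> 0 <= p -> p <= 2 * Q%:R -> x `^ p <= 1 + (x ^+ 2) ^+ Q.
Proof.
move=> x0 p0 pQ; have X0 : 0 <= (x ^+ 2) ^+ Q by rewrite exprn_ge0 // sqr_ge0.
have [x1|x1] := leP x 1.
  apply: (@le_trans _ _ 1); last by rewrite lerDl.
  by have := ge0_ler_powR p0 x0 (ler01 : 1 \in Num.nneg) x1; rewrite powR1.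
apply: (@le_trans _ _ (x `^ (2 * Q)%:R)).
  by apply: ler_powR; [exact: ltW|rewrite natrM].
by rewrite powR_mulrn // exprM lerDr.
Qed.

End ScalarSteps.

(** * The scheme in coefficients and its moments *)

Section Scheme.
Context (R : realType) (d : measure_display) (T : measurableType d) (P : probability T R).
Variables (a0 a1 a2 a3 sigma : R) (beta : nat -> R -> T -> R) (u0 : R -> R).
Hypotheses (a0_gt0 : 0 < a0) (BM : indep_std_BMs P beta) (u0H1 : in_H1 u0).

Local Notation F := (fcub a0 a1 a2 a3).
Local Notation U N tau w m := (Uscheme a0 a1 a2 a3 sigma beta u0 N tau w m).
Local Notation e N tau j := (expR (- lamN R N j ^+ 2 * tau)).

Definition ucoef N (tau : R) (m : nat) (w : T) (j : nat) : R := coef N (U N tau w m) j.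

(* The linear part of the scheme: decayed initial datum plus discrete stochastic convolution. *)
Definition ocoef N (tau : R) (m : nat) (w : T) (j : nat) : R :=
  e N tau j ^+ m * coef N (fun i => u0 (xN R N i)) j + noise beta N sigma tau w m j.

Definition ycoef N (tau : R) (m : nat) (w : T) (j : nat) : R :=
  ucoef N tau m w j - ocoef N tau m w j.

(** The exponent [6] is the [12] of the scheme, because [w12sq] is a squared norm. *)
Definition tame N (tau : R) (m : nat) (w : T) : R :=
  (1 + tau * w12sq N (ucoef N tau m w) ^+ 6)^-1.

Lemma y_plus_o N tau m w : (fun j => ycoef N tau m w j + ocoef N tau m w j) = ucoef N tau m w.
Proof. by apply/funext => j; rewrite subrK. Qed.

Section FixedGrid.
Variables (N : nat) (tau : R).
Hypotheses (N2 : (2 <= N)%N) (t01 : 0 < tau < 1).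

Let t0 : 0 < tau. Proof. by case/andP: t01. Qed.

Lemma coef_noise (D : nat -> R) j : (j < N)%N ->
  coef N (fun k => \sum_(1 <= i < N) D i * phiN R N i k) j = if j == 0%N then 0 else D j.
Proof.
move=> jN; pose D' i := if i == 0%N then 0 else D i.
rewrite -[RHS]/(D' j) -(@coef_syn R N N2 D' j jN) /coef; apply: eq_l2ip => // k _.
rewrite /syn -(big_mkord xpredT (fun i => D' i * phiN R N i k)) big_ltn; last exact: ltnW.
rewrite {1}/D' eqxx mul0r add0r; apply: eq_big_nat => i /andP[i0 _].
by rewrite /D' gtn_eqF.
Qed.

Lemma ucoefS m w j : (j < N)%N -> ucoef N tau m.+1 w j = e N tau j *
  (ucoef N tau m w j - tau * lamN R N j * (tame N tau m w * coef N (F \o syn N (ucoef N tau m w)) j)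
   + sigma * (if j == 0%N then 0 else incr beta tau j m w)).
Proof.
move=> jN; rewrite {1}/ucoef /=.
set V := U N tau w m.
have lin (A B C : vec R) (b c : R) :
    coef N (fun i => A i + b * B i + c * C i) j = coef N A j + b * coef N B j + c * coef N C j.
  rewrite /coef /l2ip !(mulrCA _ (hN R N)) -!mulrDr; congr (_ * _).
  rewrite !mulr_sumr -!big_split; apply: eq_bigr => i _ /=; ring.
rewrite lin coef_AN // !coef_semigN // coef_noise //.
have -> : coef N (FtN a0 a1 a2 a3 N tau V) j = tame N tau m w * coef N (F \o syn N (ucoef N tau m w)) j.
  rewrite /tame /coef /l2ip mulrCA; congr (_ * _); rewrite mulr_sumr; apply: eq_bigr => i _ /=.
  have -> : syn N (ucoef N tau m w) i = V i by rewrite syn_coef.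
  rewrite /FtN mulrAC mulrC; congr (_ * _); congr (_^-1); congr (1 + _ * _).
  by rewrite (_ : 12%N = (2 * 6)%N) // exprM w12normE.
rewrite -[coef N V j]/(ucoef N tau m w j).
rewrite -[beta j _ w - beta j _ w]/(incr beta tau j m w).
by move: (if _ then _ else _) => D; ring.
Qed.

Lemma ycoef_init w j : ycoef N tau 0 w j = 0.
Proof. by rewrite /ycoef /ocoef /ucoef /= expr0 mul1r addr0 subrr. Qed.

(** The noise cancels: given [O], the recursion for [Y] is deterministic, so [energy_step] and
    [mode_step] apply for each [w]. *)
Lemma ycoefS m w j : (j < N)%N -> ycoef N tau m.+1 w j = e N tau j *
  (ycoef N tau m w j - tau * lamN R N j * (tame N tau m w *
     coef N (F \o syn N (fun j => ycoef N tau m w j + ocoef N tau m w j)) j)).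
Proof.
by move=> jN; rewrite y_plus_o /ycoef ucoefS // /ocoef /= [_ ^+ m.+1]exprS; ring.
Qed.

Lemma ycoef_mode0 m w : ycoef N tau m w 0 = 0.
Proof.
have N0 : (0 < N)%N by exact: ltnW.
by elim: m => [|m IH]; [exact: ycoef_init|rewrite ycoefS // IH lamN0 mulr0 mul0r subr0 mulr0].
Qed.

Lemma tame01 m w : 0 <= tame N tau m w <= 1.
Proof.
have h : 0 <= tau * w12sq N (ucoef N tau m w) ^+ 6.
  by rewrite mulr_ge0 ?exprn_ge0 ?w12sq_ge0 // ltW.
by rewrite /tame invr_ge0 invf_le1; [apply/andP; split|]; lra.
Qed.

(** With [z = s * E^3] this is [z <= 1 + z^2]. *)
Lemma tame_bound m w (s : R) : s ^+ 2 = tau ->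
  tame N tau m w * (s * w12sq N (ucoef N tau m w) ^+ 3) <= 1.
Proof.
move=> st; rewrite /tame; set E := w12sq _ _.
have h : 0 <= tau * E ^+ 6 by rewrite mulr_ge0 ?exprn_ge0 ?w12sq_ge0 // ltW.
rewrite ler_pdivrMl; last lra.
rewrite mulr1.
have -> : tau * E ^+ 6 = (s * E ^+ 3) ^+ 2 by rewrite -st; ring.
have := sqr_ge0 (s * E ^+ 3 - 1 / 2); set z := s * E ^+ 3; nra.
Qed.

Lemma measurable_ucoef m j : (j < N)%N -> measurable_fun setT (fun w => ucoef N tau m w j).
Proof.
elim: m j => [|m IH] j jN; first by rewrite /ucoef /=; exact: measurable_cst.
under eq_fun do rewrite ucoefS //.
have msyn i : measurable_fun setT (fun w => syn N (ucoef N tau m w) i).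
  by apply: measurable_sum => k; apply: measurable_funM => //; exact: IH.
have mE : measurable_fun setT (fun w => w12sq N (ucoef N tau m w)).
  by apply: measurable_sum => k; apply: measurable_funM => //; apply: measurable_funX; exact: IH.
have mtame : measurable_fun setT (tame N tau m).
  pose f w := 1 + tau * w12sq N (ucoef N tau m w) ^+ 6.
  have f0 w : 0 <= f w.
    by rewrite /f addr_ge0 // mulr_ge0 ?exprn_ge0 ?w12sq_ge0 // ltW.
  (* The inverse is written as the real power [-1], whose measurability is at hand; the rewriting
     relies on [f >= 0]. *)
  rewrite (_ : tame N tau m = fun w => f w `^ (-1)); last first.
    by apply/funext => w; rewrite powR_inv1.
  apply: (measurableT_comp (measurable_powR (-1))).
  by apply: measurable_funD => //; apply: measurable_funM => //; exact: measurable_funX.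
have mF : measurable_fun setT (fun w => coef N (F \o syn N (ucoef N tau m w)) j).
  apply: measurable_funM => //; apply: measurable_sum => i; apply: measurable_funM => //.
  rewrite /fcub /=; apply: measurable_funD => //; apply: measurable_funD; last exact: measurable_funM.
  by apply: measurable_funD; apply: measurable_funM => //; exact: measurable_funX.
apply: measurable_funM => //; apply: measurable_funD.
  apply: measurable_funB; first exact: IH.
  by apply: measurable_funM => //; exact: measurable_funM.
apply: measurable_funM => //; case: eqP => [_|/eqP j0]; first exact: measurable_cst.
by apply: (measurable_incr BM) => //; rewrite lt0n.
Qed.

Lemma measurable_ocoef m j : measurable_fun setT (fun w => ocoef N tau m w j).
Proof.
by apply: measurable_funD; [exact: measurable_cst|exact: (measurable_noise BM)].
Qed.

Lemma measurable_ycoef m j : (j < N)%N -> measurable_fun setT (fun w => ycoef N tau m w j).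
Proof.
by move=> jN; apply: measurable_funB; [exact: measurable_ucoef|exact: measurable_ocoef].
Qed.

Lemma measurable_weighted (a : nat -> R) (Z : T -> nat -> R) :
  (forall j, (j < N)%N -> measurable_fun setT (Z ^~ j)) ->
  measurable_fun setT (fun w => \sum_(j < N) a j * Z w j ^+ 2).
Proof.
move=> mZ; apply: measurable_sum => j; apply: measurable_funM => //.
by apply: measurable_funX; exact: mZ.
Qed.

Lemma measurable_l2sq (Z : T -> nat -> R) :
  (forall j, (j < N)%N -> measurable_fun setT (Z ^~ j)) -> measurable_fun setT (fun w => l2sq N (Z w)).
Proof.
by move=> mZ; apply: measurable_sum => j; apply: measurable_funX; exact: mZ.
Qed.

(** A Poincare inequality: [lam >= 1 / 4] on nonzero modes gives [1 + lam <= 5 * lam]. *)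
Lemma w12sq_le_gradsq (a : nat -> R) : a 0%N = 0 -> w12sq N a <= 5 * gradsq N a.
Proof.
move=> a00; rewrite /w12sq /gradsq mulr_sumr; apply: ler_sum => -[[|j] jN] _ /=.
  by rewrite a00 expr0n !mulr0.
rewrite mulrA ler_wpM2r ?sqr_ge0 //; have := @lamN_gap R N N2 j.+1 jN; lra.
Qed.

End FixedGrid.

Lemma ocoef_moment Q : exists2 K : R, 0 <= K & forall N tau m, (2 <= N)%N -> 0 < tau < 1 ->
  mom_le P (fun w => (1 + w12sq N (ocoef N tau m w)) ^+ Q) K.
Proof.
case: Q => [|Q].
  exists 1 => // N tau m N2 t01; under eq_fun do rewrite expr0.
  exact: mom_le_cst.
have [D D0 HD] := in_H1_w12 u0H1.
pose K0 : R := (Q.+1.*2)`!%:R * (2 * expR (sigma ^+ 2 / 4)).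
have K00 : 0 <= K0 by rewrite mulr_ge0 // mulr_ge0 ?expR_ge0.
(* [2 * D] bounds the decayed initial datum; [10] is the [2] of the splitting times the Poincare
   constant [5], and [8] the total weight in [mom_le_gradsq]. *)
exists (2 ^+ Q.+1 * ((1 + 2 * D) ^+ Q.+1 + 10 ^+ Q.+1 * (8 ^+ Q.+1 * K0))).
  by nonneg.
move=> N tau m N2 t01; have /andP[t0 _] := t01.
have mn j : (j < N)%N -> measurable_fun setT (fun w => noise beta N sigma tau w m j).
  by move=> _; exact: (measurable_noise BM).
have Hg := mom_le_gradsq (P := P) N2 K00 mn (fun j jN => noise_moment BM sigma m Q.+1 N2 t0 jN).
have mg : measurable_fun setT (fun w => gradsq N (noise beta N sigma tau w m)).
  exact: (@measurable_weighted N (lamN R N) (fun w => noise beta N sigma tau w m) mn).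
have H10 := mom_leZ (exprn_ge0 Q.+1 (ler0n R 10)) Hg.
have D1 : 0 <= 1 + 2 * D by lra.
have := @mom_le_powD _ _ _ P (fun=> 1 + 2 * D) (fun w => 10 * gradsq N (noise beta N sigma tau w m))
  ((1 + 2 * D) ^+ Q.+1) (10 ^+ Q.+1 * (8 ^+ Q.+1 * K0)) Q.+1.
under [X in _ -> mom_le _ X _ -> _]eq_fun do rewrite exprMn.
move=> /(_ (mom_le_cst P (exprn_ge0 _ D1)) H10) H.
apply: mom_le_mono (H _ _ _ _) => {H} //.
- apply: measurable_funX; apply: measurable_funD => //.
  by apply: (@measurable_weighted N (fun j => 1 + lamN R N j)) => j _; exact: measurable_ocoef.
- move=> w; have B0 := w12sq_ge0 N (ocoef N tau m w).
  have g10 : 0 <= 10 * gradsq N (noise beta N sigma tau w m) by rewrite mulr_ge0 ?gradsq_ge0.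
  have h1 : w12sq N (ocoef N tau m w) <= 2 * w12sq N (fun j => e N tau j ^+ m * coef N (fun i => u0 (xN R N i)) j) +
     2 * w12sq N (noise beta N sigma tau w m).
    by apply: w12sq_half => j _; exact: sqrD_le.
  have h2 : w12sq N (fun j => e N tau j ^+ m * coef N (fun i => u0 (xN R N i)) j) <= D.
    apply: le_trans (HD N N2); apply: ler_sum => j _; apply: ler_wpM2l.
      by have := lamN_ge0 R N j; lra.
    rewrite exprMn ler_piMl ?sqr_ge0 // -exprM exprn_ile1 ?expR_ge0 // expR_le1 mulNr oppr_le0.
    by rewrite mulr_ge0 ?sqr_ge0 // ltW.
  have h3 := w12sq_le_gradsq N2 (noise0 beta N sigma tau w m).
  have h4 : 1 + w12sq N (ocoef N tau m w) <= 1 + 2 * D + 10 * gradsq N (noise beta N sigma tau w m).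
    lra.
  have pos : 0 <= 1 + w12sq N (ocoef N tau m w) by rewrite addr_ge0.
  by rewrite exprn_ge0 //= lerXn2r ?nnegrE // addr_ge0.
- exact: measurable_funM.
- by move=> w; rewrite mulr_ge0 ?gradsq_ge0.
Qed.

Lemma ycoef_l2_moment Q : exists2 K : R, 0 <= K & forall N tau m, (2 <= N)%N -> 0 < tau < 1 ->
  mom_le P (fun w => l2sq N (ycoef N tau m w) ^+ Q.+1) K.
Proof.
have [C C0 HC] := energy_step a1 a2 a3 a0_gt0.
have [K K0 HK] := ocoef_moment (4 * Q.+1).
exists (C ^+ Q.+1 * K); first by rewrite mulr_ge0 // exprn_ge0.
move=> N tau m N2 t01; have /andP[t0 t1] := t01.
apply: (@mom_le_contract _ _ _ P (fun n w => l2sq N (ycoef N tau n w))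
  (fun n w => C * (1 + w12sq N (ocoef N tau n w)) ^+ 4) (tau / 18)).
- by apply/andP; split; lra.
- by move=> n; apply: measurable_l2sq => j jN; exact: measurable_ycoef.
- by move=> n w; exact: l2sq_ge0.
- by move=> n w; rewrite mulr_ge0 // exprn_ge0 // addr_ge0 // w12sq_ge0.
- by move=> w; rewrite /l2sq big1 // => j _; rewrite ycoef_init expr0n.
- move=> n w.
  have := HC N tau (Num.sqrt tau) (tame N tau n w) (ycoef N tau n w) (ocoef N tau n w) N2 t01
    (sqrtr_ge0 _) (sqr_sqrtr (ltW t0)) (tame01 N t01 n w).
  rewrite {1}y_plus_o => /(_ (tame_bound N t01 n w (sqr_sqrtr (ltW t0))) (ycoef_mode0 tau N2 n w)).
  apply: le_trans; rewrite le_eqVlt; apply/orP; left; apply/eqP.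
  by apply: eq_bigr => j _; rewrite ycoefS.
- by rewrite mulr_ge0 // exprn_ge0.
- move=> n _; under eq_fun do rewrite exprMn -exprM.
  by apply: mom_leZ; [exact: exprn_ge0|exact: HK].
Qed.

(** The bound [M] must reproduce itself: assuming it at all earlier times bounds the forcing by [G],
    and [8^(Q+1) * G <= M] returns it at time [m]. Finiteness of the moments comes out of the same
    induction. *)
Lemma ycoef_grad_moment Q : exists2 K : R, 0 <= K & forall N tau m, (2 <= N)%N -> 0 < tau < 1 ->
  mom_le P (fun w => gradsq N (ycoef N tau m w) ^+ Q.+1) K.
Proof.
(* The total weight [8] and the factor [2] of [powD_le] multiply [eps] to [1 / 2], so the gradient
   feeds back at most [M / 2]. The definition of [M] reserves the other half for the remaining
   term. *)
have eps0 : (0 : R) < 32^-1 by rewrite invr_gt0.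
have [C C0 HC] := flux_bound a1 a2 a3 a0_gt0 eps0.
have [K1 K10 HK1] := ocoef_moment (5 * Q.+1).
(* The predecessor offsets the exponent [Q.+1] in [ycoef_l2_moment]; the moment obtained has order
   [5 * Q.+1]. *)
have [K2 K20 HK2] := ycoef_l2_moment (5 * Q.+1).-1.
pose KZ := 2 ^+ (5 * Q.+1) * (K1 + K2).
have KZ0 : 0 <= KZ by rewrite /KZ; nonneg.
pose M := 2 * (16 ^+ Q.+1 * (C ^+ Q.+1 * KZ)).
have M0 : 0 <= M by rewrite /M; nonneg.
exists M => // N tau m N2 t01; have /andP[t0 t1] := t01.
pose Z n w := 1 + w12sq N (ocoef N tau n w) + l2sq N (ycoef N tau n w).
have mo n : measurable_fun setT (fun w => 1 + w12sq N (ocoef N tau n w)).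
  apply: measurable_funD => //.
  by apply: (@measurable_weighted N (fun j => 1 + lamN R N j)) => j _; exact: measurable_ocoef.
have ml n : measurable_fun setT (fun w => l2sq N (ycoef N tau n w)).
  by apply: measurable_l2sq => j jN; exact: measurable_ycoef.
have mg n : measurable_fun setT (fun w => gradsq N (ycoef N tau n w)).
  by apply: (@measurable_weighted N (lamN R N)) => j jN; exact: measurable_ycoef.
have Z0 n w : 0 <= Z n w by rewrite /Z !addr_ge0 ?w12sq_ge0 ?l2sq_ge0.
have HZ n : mom_le P (fun w => Z n w ^+ (5 * Q.+1)) KZ.
  apply: mom_le_powD => //.
  - exact: HK1.
  - by have := HK2 N tau n N2 t01; rewrite prednK.
  - by move=> w; rewrite addr_ge0 // w12sq_ge0.
  - by move=> w; exact: l2sq_ge0.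
pose g n w := 32^-1 * gradsq N (ycoef N tau n w) + C * Z n w ^+ 5.
have g0 n w : 0 <= g n w by rewrite addr_ge0 ?mulr_ge0 ?gradsq_ge0 ?exprn_ge0.
have mgg n : measurable_fun setT (g n).
  apply: measurable_funD; first exact: measurable_funM.
  by apply: measurable_funM => //; apply: measurable_funX; exact: measurable_funD.
pose G := 2 ^+ Q.+1 * (32^-1 ^+ Q.+1 * M + C ^+ Q.+1 * KZ).
have G0 : 0 <= G by rewrite /G; nonneg.
elim/ltn_ind: m => m IH.
have Hg n : (n < m)%N -> mom_le P (fun w => g n w ^+ Q.+1) G.
  move=> nm; apply: mom_le_powD.
  - under eq_fun do rewrite exprMn.
    by apply: mom_leZ; [exact: exprn_ge0|exact: IH].
  - under eq_fun do rewrite exprMn -exprM.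
    by apply: mom_leZ; [exact: exprn_ge0|exact: HZ].
  - exact: measurable_funM.
  - by apply: measurable_funM => //; apply: measurable_funX; exact: measurable_funD.
  - by move=> w; rewrite mulr_ge0 ?gradsq_ge0.
  - by move=> w; rewrite mulr_ge0 // exprn_ge0.
apply: (@mom_le_weak _ _ _ P _ (8 ^+ Q.+1 * G)).
  have -> : 8 ^+ Q.+1 * G = (2^-1) ^+ Q.+1 * M + M / 2.
    rewrite /G mulrA -exprMn mulrDr mulrA -exprMn.
    have -> : (8 * 2 : R) = 16 by ring.
    have -> : (16 / 32 : R) = 2^-1 by field.
    by rewrite /M; field.
  have : (2^-1 : R) ^+ Q.+1 <= 2^-1.
    by rewrite exprS ler_piMr ?invr_ge0 // exprn_ile1 ?invr_ge0 // invf_le1 //; lra.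
  move=> /(ler_wpM2r M0); lra.
apply: (mom_le_gradsq N2 G0); first by move=> j jN; exact: measurable_ycoef.
move=> j jN; have l0 := lamN_gt0 R N2 jN; have /andP[j0 jN'] := jN.
set l := lamN R N j in l0 *.
have e01 : 0 <= 1 - e N tau j <= 1.
  rewrite subr_ge0 expR_le1 mulNr oppr_le0 gerBl expR_ge0 andbT.
  by rewrite mulr_ge0 ?sqr_ge0 // ltW.
apply: (@mom_le_contract _ _ _ P (fun n w => ycoef N tau n w j ^+ 2)
  (fun n w => l ^- 2 * g n w) (1 - e N tau j)) => //.
- by move=> n; apply: measurable_funX; exact: measurable_ycoef.
- by move=> n w; exact: sqr_ge0.
- by move=> n w; rewrite mulr_ge0 // invr_ge0 sqr_ge0.
- by move=> w; rewrite ycoef_init expr0n.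
- move=> n w; rewrite subKr ycoefS //.
  apply: le_trans (mode_step _ _ l0 t0) _.
  rewrite lerD2l; apply: ler_wpM2l; first by case/andP: e01.
  apply: ler_wpM2l; first by rewrite invr_ge0 sqr_ge0.
  have := HC N (ycoef N tau n w) (ocoef N tau n w) j N2 (ycoef_mode0 tau N2 n w).
  rewrite -addrA [l2sq _ _ + _]addrC addrA -/(Z n w) -/(g n w); apply: le_trans.
  have /andP[th0 th1] := tame01 N t01 n w.
  by rewrite exprMn ler_piMl ?sqr_ge0 // expr_le1.
- by rewrite mulr_ge0 // exprn_ge0 // invr_ge0 sqr_ge0.
- move=> n nm; under eq_fun do rewrite exprMn.
  rewrite mulrC; apply: mom_leZ; last exact: Hg.
  by rewrite exprn_ge0 // invr_ge0 sqr_ge0.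
Qed.

Lemma ucoef_moment Q : exists2 K : R, 0 <= K & forall N tau m, (2 <= N)%N -> 0 < tau < 1 ->
  mom_le P (fun w => w12sq N (ucoef N tau m w) ^+ Q.+1) K.
Proof.
have [K1 K10 HK1] := ycoef_grad_moment Q.
have [K2 K20 HK2] := ocoef_moment Q.+1.
exists (2 ^+ Q.+1 * (10 ^+ Q.+1 * K1 + 2 ^+ Q.+1 * K2)); first by nonneg.
move=> N tau m N2 t01.
have mo : measurable_fun setT (fun w => 1 + w12sq N (ocoef N tau m w)).
  apply: measurable_funD => //.
  by apply: (@measurable_weighted N (fun j => 1 + lamN R N j)) => j _; exact: measurable_ocoef.
have mg : measurable_fun setT (fun w => gradsq N (ycoef N tau m w)).
  by apply: (@measurable_weighted N (lamN R N)) => j jN; exact: measurable_ycoef.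
have H1 : mom_le P (fun w => (10 * gradsq N (ycoef N tau m w)) ^+ Q.+1) (10 ^+ Q.+1 * K1).
  under eq_fun do rewrite exprMn.
  by apply: mom_leZ; [exact: exprn_ge0|exact: HK1].
have H2 : mom_le P (fun w => (2 * (1 + w12sq N (ocoef N tau m w))) ^+ Q.+1) (2 ^+ Q.+1 * K2).
  under eq_fun do rewrite exprMn.
  by apply: mom_leZ; [exact: exprn_ge0|exact: HK2].
have o0 w : 0 <= 2 * (1 + w12sq N (ocoef N tau m w)).
  by rewrite mulr_ge0 // addr_ge0 // w12sq_ge0.
have y0 w : 0 <= 10 * gradsq N (ycoef N tau m w) by rewrite mulr_ge0 // gradsq_ge0.
apply: mom_le_mono (mom_le_powD H1 H2 _ _ _ _) => //.
- apply: measurable_funX.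
  by apply: (@measurable_weighted N (fun j => 1 + lamN R N j)) => j jN; exact: measurable_ucoef.
- move=> w; rewrite exprn_ge0 ?w12sq_ge0 //= lerXn2r ?nnegrE ?addr_ge0 ?w12sq_ge0 //.
  have h1 : w12sq N (ucoef N tau m w) <= 2 * w12sq N (ycoef N tau m w) + 2 * w12sq N (ocoef N tau m w).
    by apply: w12sq_half => j _; rewrite -y_plus_o; exact: sqrD_le.
  have h2 := w12sq_le_gradsq N2 (ycoef_mode0 tau N2 m w).
  lra.
- exact: measurable_funM.
- exact: measurable_funM.
Qed.

(** Any nonnegative [X] dominated by the [w12] norm is allowed, measurable or not, so that one
    statement yields both conclusions: [k = 3] for the maximum norm, [k = 1] for the [w12] norm
    itself. *)
Lemma Uscheme_moment (k p : R) : 0 <= k -> 0 <= p -> exists C : R,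
  forall (tau : R) (N m : nat) (X : T -> R), 0 < tau < 1 -> (2 <= N)%N ->
  (forall w, 0 <= X w <= k * w12norm N (U N tau w m)) ->
  (\int[P]_w (X w `^ p)%:E <= C%:E)%E.
Proof.
move=> k0 p0; pose Q := Num.bound p.
have pQ : p <= 2 * Q.+1%:R.
  have := archi_boundP p0; rewrite -/Q -natr1 => h; have : (0 : R) <= Q%:R by []; lra.
have [K K0 HK] := ucoef_moment Q.
exists (1 + (k ^+ 2) ^+ Q.+1 * K) => tau N m X t01 N2 XU.
have k20 : 0 <= (k ^+ 2) ^+ Q.+1 by rewrite exprn_ge0 // sqr_ge0.
have [_ _] := mom_leD (mom_le_cst P (ler01 : 0 <= 1 :> R)) (mom_leZ k20 (HK N tau m N2 t01)).
apply: le_trans; apply: le_integral_pointwise => w; rewrite lee_fin; first exact: powR_ge0.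
have /andP[x0 xU] := XU w.
apply: le_trans (powR_le_even x0 p0 pQ) _.
rewrite lerD2l -exprMn lerXn2r ?nnegrE ?mulr_ge0 ?sqr_ge0 ?w12sq_ge0 //.
have -> : w12sq N (ucoef N tau m w) = w12norm N (U N tau w m) ^+ 2 by rewrite w12normE.
by rewrite -exprMn lerXn2r ?nnegrE // (le_trans x0 xU).
Qed.

End Scheme.

Theorem theorem4p1 (R : realType) (d : measure_display) (T : measurableType d)
  (P : probability T R) (a0 a1 a2 a3 sigma : R) (beta : nat -> R -> T -> R)
  (u0 : R -> R) :
  0 < a0 ->
  (exists c : R, c < 1 /\
     forall x : R, - (3 * a0 * x ^+ 2 + 2 * a1 * x + a2) <= c) ->
  indep_std_BMs P beta ->
  in_H1 u0 ->
  forall p : R, 2 <= p ->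
    (exists C : R, forall (tau : R) (N m : nat), 0 < tau < 1 -> (2 <= N)%N ->
       (\int[P]_w
          ((Linf_norm (PN N (Uscheme a0 a1 a2 a3 sigma beta u0 N tau w m))) `^ p)%:E
        <= C%:E)%E)
    /\
    (exists C : R, forall (tau : R) (N m : nat), 0 < tau < 1 -> (2 <= N)%N ->
       (\int[P]_w
          ((w12norm N (Uscheme a0 a1 a2 a3 sigma beta u0 N tau w m)) `^ p)%:E
        <= C%:E)%E).
Proof.
move=> a0_gt0 _ BM u0H1 p p2.
have p0 : 0 <= p by lra.
split.
  (* The factor [3] is the square root of the [9] in [sup_w12]. *)
  have [C HC] := Uscheme_moment a1 a2 a3 sigma a0_gt0 BM u0H1 (ler0n R 3) p0.
  exists C => tau N m t01 N2; apply: (HC tau N m _ t01 N2) => w.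
  set V := Uscheme _ _ _ _ _ _ _ _ _ _ _.
  have w0 : 0 <= w12norm N V by exact: sqrtr_ge0.
  apply: Linf_norm_PN => //; first by rewrite mulr_ge0.
  move=> i iN; rewrite -(@ler_pXn2r _ 2) ?nnegrE ?mulr_ge0 // real_normK ?num_real //.
  have := sup_w12 N2 (coef N V) i; rewrite syn_coef // /w12sq -w12normE // exprMn.
  by rewrite (_ : 3 ^+ 2 = 9) //; ring.
have [C HC] := Uscheme_moment a1 a2 a3 sigma a0_gt0 BM u0H1 (ler01 : 0 <= 1 :> R) p0.
exists C => tau N m t01 N2; apply: (HC tau N m _ t01 N2) => w.
by rewrite mul1r lexx andbT sqrtr_ge0.
Qed.
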